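(* For all information structures $u,v\in\mathcal{U}$, $$\sup_{g\in\mathcal{G}}\bigl(\mathrm{val}(v,g)-\mathrm{val}(u,g)\bigr)=\min_{q_1\in\mathcal{Q},\,q_2\in\mathcal{Q}}\|q_1.u-v.q_2\|.$$ If moreover $u,v\in\mathcal{U}(L)$ for some integer $L\ge 1$, then all the optima can be attained by $L$-based structures, i.e. the supremum on the left-hand side is attained by some $g\in\mathcal{G}(L)$ and the minimum on the right-hand side is attained by some $q_1,q_2\in\mathcal{Q}(L)$. Hence, for all $u,v\in\mathcal U$, $$d(u,v)=\max\Bigl\{\min_{q_1,q_2\in\mathcal{Q}}\|q_1.u-v.q_2\|,\ \min_{q_1,q_2\in\mathcal{Q}}\|u.q_1-q_2.v\|\Bigr\}.$$
   Context: $K$ is a finite set with $|K|\ge 2$ and $\mathbb{N}=\{0,1,2,\dots\}$. $\Delta(X)$ denotes the set of probabilities on $X$. An information structure is an element $u$ of $\mathcal{U}=\Delta(K\times\mathbb{N}\times\mathbb{N})$; in $(k,c,d)$, $k$ is the state, $c$ the signal of player 1, $d$ the signal of player 2. For $L\ge 1$, $\mathcal{U}(L)$ is the set of $u\in\mathcal{U}$ under which each player's signal is $\le L-1$ with probability 1. A payoff function is a map $g:K\times I\times J\to[-1,1]$ with $I,J$ nonempty finite sets. $\mathcal{G}(L)$ is the set of payoff functions with $|I|,|J|\le L$, and $\mathcal{G}=\bigcup_{L\ge1}\mathcal{G}(L)$. The zero-sum Bayesian game $\Gamma(u,g)$: $(k,c,d)$ is drawn from $u$, player 1 learns $c$, player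 2 learns $d$, simultaneously player 1 chooses $i\in I$ and player 2 chooses $j\in J$, and player 1 (the maximizer) receives $g(k,i,j)$ from player 2. $\mathrm{val}(u,g)$ is the value (in mixed/behavior strategies) of $\Gamma(u,g)$. The value-based distance is $d(u,v)=\sup_{g\in\mathcal{G}}|\mathrm{val}(u,g)-\mathrm{val}(v,g)|$. The total variation norm is $\|u-v\|=\sum_{k,c,d}|u(k,c,d)-v(k,c,d)|$. A garbling is a map $q:\mathbb{N}\to\Delta(\mathbb{N})$, written $q(c'|c)=q(c)(c')$; $\mathcal{Q}$ is the set of garblings and $\mathcal{Q}(L)$ the set of garblings with values in $\Delta(\{0,\dots,L-1\})$. For $u\in\mathcal{U}$ and $q\in\mathcal{Q}$, the information structures $q.u$ and $u.q$ are defined by $$q.u(k,c,d)=\sum_{c'}u(k,c',d)\,q(c|c'),\qquad u.q(k,c,d)=\sum_{d'}u(k,c,d')\,q(d|d').$$ *)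

(* Defs.v *)
From HB Require Import structures.
From mathcomp Require Import all_boot all_order all_algebra.
From mathcomp Require Import mathcomp_extra boolp classical_sets functions.
From mathcomp Require Import cardinality fsbigop reals ereal esum numfun.

Set Implicit Arguments.
Unset Strict Implicit.
Unset Printing Implicit Defensive.

Import Order.TTheory GRing.Theory Num.Theory.

Local Open Scope classical_set_scope.
Local Open Scope ring_scope.

(* \esum is only meaningful for nonnegative terms; this is the unconditional
   sum of an absolutely summable real family, as in esumB. *)
Definition tsum (R : realType) (T : choiceType) (f : T -> R) : R :=
  let F := EFin \o f in
  fine (\esum_(x in [set: T]) (F^\+)%E x - \esum_(x in [set: T]) (F^\-)%E x)%E.

(* Probability mass functions; every T used below is countable, so these are
   all the probabilities on T. *)
Record prob (R : realType) (T : choiceType) := Prob {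
  pmf :> T -> R;
  pmf_ge0 : forall x, 0 <= pmf x;
  pmf_sum1 : (\esum_(x in [set: T]) (pmf x)%:E = 1)%E
}.

Definition Pr (R : realType) (T : choiceType) (p : prob R T) (A : set T) :
    \bar R :=
  (\esum_(x in A) (p x)%:E)%E.

Definition is_minimum (R : realType) (A : set R) (m : R) : Prop :=
  A m /\ lbound A m.

Section InformationStructures.
Variables (R : realType) (K : finType).

(* In (k, c, d), k is the state, c the signal of player 1 (the maximizer) and
   d the signal of player 2. *)
Definition outcome : choiceType := (K * nat * nat)%type.

Definition info := prob R outcome.

Definition in_info (L : nat) (u : info) : Prop :=
  Pr u [set x | (x.1.2 <= L - 1)%N] = 1%E /\
  Pr u [set x | (x.2 <= L - 1)%N] = 1%E.

(* q c c' is the probability q(c'|c) of drawing c' from c. *)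
Definition garbling := nat -> prob R nat.

Definition in_garbling (L : nat) (q : garbling) : Prop :=
  forall c c', (L <= c')%N -> q c c' = 0.

Definition garble1 (q : garbling) (u : info) : outcome -> R :=
  fun x => let: (k, c, d) := x in tsum (fun c' => u (k, c', d) * q c' c).

Definition garble2 (u : info) (q : garbling) : outcome -> R :=
  fun x => let: (k, c, d) := x in tsum (fun d' => u (k, c, d') * q d' d).

Definition tv_dist (a b : outcome -> R) : R := tsum (fun x => `|a x - b x|).

End InformationStructures.

Section Games.
Variables (R : realType) (K : finType).

Definition in_G (I J : finType) (g : K -> I -> J -> R) : Prop :=
  [/\ (0 < #|I|)%N, (0 < #|J|)%N & forall k i j, -1 <= g k i j <= 1].

Definition in_GL (L : nat) (I J : finType) (g : K -> I -> J -> R) : Prop :=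
  [/\ in_G g, (#|I| <= L)%N & (#|J| <= L)%N].

(* Behavior strategies: a mixed action after each signal. *)
Definition strategy (A : finType) := nat -> prob R A.

Section Value.
Variables (I J : finType) (u : info R K) (g : K -> I -> J -> R).

Definition expected_payoff (s : strategy I) (t : strategy J) : R :=
  tsum (fun x : outcome K => let: (k, c, d) := x in
    u (k, c, d) * \sum_i \sum_j s c i * t d j * g k i j).

Definition maxmin : R :=
  sup (range (fun s => inf (range (fun t => expected_payoff s t)))).

Definition minmax : R :=
  inf (range (fun t => sup (range (fun s => expected_payoff s t)))).

Definition is_value (w : R) : Prop := w = maxmin /\ w = minmax.

(* The value exists for every g in G; the default 2 lies outside the payoff
   range [-1, 1]. *)
Definition game_value : R := xget 2 [set w | is_value w].

End Value.

Definition val_gain (u v : info R K) : R :=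
  sup [set r | exists (I J : finType) (g : K -> I -> J -> R),
    in_G g /\ r = game_value v g - game_value u g].

Definition val_dist (u v : info R K) : R :=
  sup [set r | exists (I J : finType) (g : K -> I -> J -> R),
    in_G g /\ r = `|game_value u g - game_value v g|].

Definition garbling_gaps (u v : info R K) : set R :=
  [set r | exists q1 q2 : garbling R,
    r = tv_dist (garble1 q1 u) (garble2 v q2)].

Definition garbling_gaps' (u v : info R K) : set R :=
  [set r | exists q1 q2 : garbling R,
    r = tv_dist (garble2 u q1) (garble1 q2 v)].

End Games.

(* Main.v *)
Require Import Defs.
From HB Require Import structures.
From mathcomp Require Import all_boot all_order all_algebra.
From mathcomp Require Import mathcomp_extra boolp classical_sets functions.
From mathcomp Require Import cardinality fsbigop reals ereal esum numfun.
From mathcomp Require Import topology normedtype sequences.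
From mathcomp Require Import ring lra.

Set Implicit Arguments.
Unset Strict Implicit.
Unset Printing Implicit Defensive.

Import Order.TTheory GRing.Theory Num.Theory.
Import numFieldNormedType.Exports.

Local Open Scope classical_set_scope.
Local Open Scope ring_scope.

(** Two facts meet. The first is that a garbling of one's own signal can be
    simulated inside a strategy: a strategy [t] of player 2 in the structure
    [v.q2] yields the strategy [t] after [q2] in [v] with the same payoffs
    ([payoff_garbled2]), and likewise for player 1 in [q1.u]. So
    [val (v, g) <= val (v.q2, g)] and [val (q1.u, g) <= val (u, g)], while the
    values of [g] at [q1.u] and at [v.q2] differ by at most the total variation
    of these two structures, the payoffs being in [[-1, 1]]. Every garbling gap
    is therefore an upper bound of every gain ([value_gap_le_tv]).

    The second is duality. The norm of [q1.u - v.q2] is the maximum over test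
    functions [g] with values in [[-1, 1]] of the pairing of [g] with
    [v.q2 - q1.u], which is affine in [(q1, q2)]. A minimax theorem exchanges
    the minimum over garblings with the maximum over [g] and produces a single
    [g] whose pairing with [v.q2 - q1.u] is at least the minimal gap for all
    garblings at once ([dual_game]). Read [g k i j] as a game in which each
    player announces a signal. In [v], if player 1 announces his signal
    truthfully, the strategies of player 2 are exactly the garblings [q2], so
    player 1 secures the least pairing of [g] with [v.q2]; symmetrically, a
    truthful player 2 holds player 1 in [u] down to the greatest pairing of [g]
    with [q1.u] ([le_value_gap]). Hence [val (v, g) - val (u, g)] reaches the
    minimal gap.

    Announcements must be finitely many: [n + 1] labels are used, at a cost of
    at most four times the probability that a signal of [u] or [v] exceeds [n].
    This cost tends to [0], and it is [0] when the signals are below [n + 1],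
    in which case [g] is an exact optimum.

    The minimax theorem that is needed ([minimax]) has an arbitrary convex set
    on one side and finitely many affine functions on the other. It follows
    from first-order optimality of a near-minimizer of a sum of squared
    excesses, without any topology on the convex set. It also gives the
    existence of the value with infinitely many signals, once the strategies of
    player 2 are approximated by mixtures of finitely many pure ones
    ([pure_response]).

    The minimum over garblings is attained because the total variation distance
    of two probabilities is [2 - 2 * overlap], where the overlap is the sum of
    the pointwise minima. Along a maximizing sequence of garblings, probability
    may escape to infinity, but never where the two structures overlap: [q1.u]
    keeps the law of player 2's signals in [u], and [v.q2] that of player 1's
    signals in [v] ([overlap_tight]). So the overlap passes to the limit, and
    completing the limit into garblings only increases it
    ([min_gap_attained]). *)

(** * Absolutely convergent sums *)

Section AbsolutelyConvergentSums.
Variables (R : realType) (T : choiceType).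
Implicit Types (f g h : T -> R).

(** The families on which [tsum] is the usual, linear, sum: on the others one
    of the two sums whose difference defines it is infinite. *)
Definition asum f := summable [set: T] (EFin \o f).

Lemma le_asum f g : (forall x, `|f x| <= g x) -> asum g -> asum f.
Proof.
move=> fg; apply: le_lt_trans; apply: le_esum => x _ /=.
by rewrite lee_fin (le_trans (fg x))// ler_norm.
Qed.

Lemma asum_norm f : asum f -> asum (fun x => `|f x|).
Proof.
apply: le_lt_trans; apply: le_esum => x _ /=.
by rewrite lee_fin normr_id.
Qed.

Lemma asumD f g : asum f -> asum g -> asum (fun x => f x + g x).
Proof. exact: summableD. Qed.

Lemma asumN f : asum f -> asum (fun x => - f x).
Proof. by rewrite /asum summableN. Qed.

Lemma asumB f g : asum f -> asum g -> asum (fun x => f x - g x).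
Proof. by move=> sf sg; apply: asumD => //; apply: asumN. Qed.

Lemma asum_fin f : asum f -> (\esum_(x in [set: T]) `|f x|%:E)%E \is a fin_num.
Proof. by rewrite /asum summableE. Qed.

Lemma asum_ge0P f : (forall x, 0 <= f x) ->
  asum f <-> (\esum_(x in [set: T]) (f x)%:E)%E \is a fin_num.
Proof.
move=> f0; rewrite /asum summableE.
by rewrite (@eq_esum _ _ _ _ (EFin \o f))// => x _ /=; rewrite ger0_norm.
Qed.

Lemma tsum_ge0E f : (forall x, 0 <= f x) ->
  tsum f = fine (\esum_(x in [set: T]) (f x)%:E)%E.
Proof.
move=> f0; rewrite /tsum (@eq_esum _ _ _ _ (EFin \o f)); last first.
  by move=> x _; rewrite funeposE/= max_l// lee_fin.
rewrite [X in (_ - X)%E]esum1 ?sube0// => x _.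
by rewrite funenegE/= max_r// lee_fin oppr_le0.
Qed.

Lemma esumEtsum f : (forall x, 0 <= f x) -> asum f ->
  (\esum_(x in [set: T]) (f x)%:E = (tsum f)%:E)%E.
Proof. by move=> f0 /(asum_ge0P f0) sf; rewrite tsum_ge0E// fineK. Qed.

Lemma eq_tsum f g : f =1 g -> tsum f = tsum g.
Proof. by move/funext ->. Qed.

Lemma tsum_ge0B f g : (forall x, 0 <= f x) -> (forall x, 0 <= g x) ->
  asum f -> asum g -> tsum (fun x => f x - g x) = tsum f - tsum g.
Proof.
move=> f0 g0 sf sg.
have := esumB sf sg (fun x _ => f0 x) (fun x _ => g0 x).
rewrite (esumEtsum f0 sf) (esumEtsum g0 sg) => e.
by rewrite /tsum -[LHS]/(fine (_ - _)%E) [X in fine X]e.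
Qed.

Lemma tsum_ge0D f g : (forall x, 0 <= f x) -> (forall x, 0 <= g x) ->
  asum f -> asum g -> tsum (fun x => f x + g x) = tsum f + tsum g.
Proof.
move=> f0 g0 sf sg; have fg0 x : 0 <= f x + g x by exact: addr_ge0.
apply: EFin_inj; rewrite -(esumEtsum fg0 (asumD sf sg)).
rewrite EFinD -(esumEtsum f0 sf) -(esumEtsum g0 sg) -esumD//.
  by move=> x _; rewrite lee_fin.
by move=> x _; rewrite lee_fin.
Qed.

Let posBneg f x : f x = f^\+ x - f^\- x.
Proof. by rewrite -{1}(funrposBneg f). Qed.

Lemma asum_pos f : asum f -> asum (f^\+).
Proof.
move/asum_norm; apply: le_asum => x; rewrite ger0_norm ?funrpos_ge0// /funrpos.
by rewrite ge_max normr_ge0 ler_norm.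
Qed.

Lemma asum_neg f : asum f -> asum (f^\-).
Proof.
move/asum_norm; apply: le_asum => x; rewrite ger0_norm ?funrneg_ge0// /funrneg.
by rewrite ge_max normr_ge0 -normrN ler_norm.
Qed.

Lemma tsum_posneg f : asum f -> tsum f = tsum (f^\+) - tsum (f^\-).
Proof.
move=> sf; rewrite -tsum_ge0B; [|exact: funrpos_ge0|exact: funrneg_ge0
  |exact: asum_pos|exact: asum_neg].
by apply: eq_tsum => x; exact: posBneg.
Qed.

(** Linearity of [tsum] comes from this freedom to choose the splitting: the
    positive part of [f + g] is not the sum of the positive parts. *)
Lemma tsum_split f g h : (forall x, 0 <= g x) -> (forall x, 0 <= h x) ->
  asum g -> asum h -> (forall x, f x = g x - h x) -> tsum f = tsum g - tsum h.
Proof. by move=> g0 h0 sg sh fE; rewrite -tsum_ge0B//; exact: eq_tsum. Qed.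

Lemma tsumD f g : asum f -> asum g ->
  tsum (fun x => f x + g x) = tsum f + tsum g.
Proof.
move=> sf sg.
rewrite (@tsum_split _ (fun x => f^\+ x + g^\+ x)
                       (fun x => f^\- x + g^\- x)).
- rewrite !tsum_ge0D ?(tsum_posneg sf) ?(tsum_posneg sg)//;
    do ?[exact: funrpos_ge0|exact: funrneg_ge0|exact: asum_pos|exact: asum_neg].
  by lra.
- by move=> x; rewrite addr_ge0 ?funrpos_ge0.
- by move=> x; rewrite addr_ge0 ?funrneg_ge0.
- by apply: asumD; exact: asum_pos.
- by apply: asumD; exact: asum_neg.
- by move=> x; rewrite (posBneg f) (posBneg g); lra.
Qed.

Lemma tsumN f : asum f -> tsum (fun x => - f x) = - tsum f.
Proof.
move=> sf; rewrite (@tsum_split _ (f^\-) (f^\+)).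
- by rewrite (tsum_posneg sf) opprB.
- exact: funrneg_ge0.
- exact: funrpos_ge0.
- exact: asum_neg.
- exact: asum_pos.
- by move=> x; rewrite (posBneg f) opprB.
Qed.

Lemma tsumB f g : asum f -> asum g ->
  tsum (fun x => f x - g x) = tsum f - tsum g.
Proof. by move=> sf sg; rewrite tsumD// ?tsumN//; exact: asumN. Qed.

Lemma esumZl (r : R) f : 0 <= r ->
  (\esum_(x in [set: T]) (r * f x)%:E =
   r%:E * \esum_(x in [set: T]) (f x)%:E)%E.
Proof.
move=> r0; rewrite /esum -ereal_supZl//; last first.
  apply/set0P; exists (\sum_(x \in set0) (f x)%:E)%E.
  by exists set0 => //; exact: fsets_set0.
congr ereal_sup; apply/seteqP; split => [_ [X XS <-]|_ [_ [X XS <-] <-]].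
  exists (\sum_(x \in X) (f x)%:E)%E; first by exists X.
  by case: XS => finX _; rewrite !fsbig_finite//= !sumEFin -EFinM mulr_sumr.
exists X => //; case: XS => finX _.
by rewrite !fsbig_finite//= !sumEFin -EFinM mulr_sumr.
Qed.

Lemma asumZ (r : R) f : asum f -> asum (fun x => r * f x).
Proof.
move=> sf; rewrite /asum summableE.
rewrite (@eq_esum _ _ _ _ (fun x => (`|r| * `|f x|)%:E)); last first.
  by move=> x _ /=; rewrite normrM.
by rewrite esumZl// fin_numM// asum_fin.
Qed.

Lemma tsum_ge0Z (r : R) f : 0 <= r -> (forall x, 0 <= f x) -> asum f ->
  tsum (fun x => r * f x) = r * tsum f.
Proof.
move=> r0 f0 sf; rewrite tsum_ge0E; last by move=> x; exact: mulr_ge0.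
by rewrite esumZl// esumEtsum.
Qed.

Lemma tsumZ (r : R) f : asum f -> tsum (fun x => r * f x) = r * tsum f.
Proof.
wlog r0 : r / 0 <= r.
  move=> wl sf; have [r0|/ltW r0] := leP 0 r; first exact: wl.
  rewrite (@eq_tsum _ (fun x => - (- r * f x))) ?tsumN ?wl//; first lra.
  - by rewrite oppr_ge0.
  - exact: asumZ.
  - by move=> x; lra.
move=> sf; rewrite (@tsum_split _ (fun x => r * f^\+ x) (fun x => r * f^\- x)).
- rewrite !tsum_ge0Z// ?(tsum_posneg sf) ?mulrBr//;
    do ?[exact: funrpos_ge0|exact: funrneg_ge0|exact: asum_pos|exact: asum_neg].
- by move=> x; rewrite mulr_ge0 ?funrpos_ge0.
- by move=> x; rewrite mulr_ge0 ?funrneg_ge0.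
- by apply: asumZ; exact: asum_pos.
- by apply: asumZ; exact: asum_neg.
- by move=> x; rewrite (posBneg f) mulrBr.
Qed.

Lemma tsum_ge0 f : (forall x, 0 <= f x) -> 0 <= tsum f.
Proof.
by move=> f0; rewrite tsum_ge0E// fine_ge0// esum_ge0// => x _; rewrite lee_fin.
Qed.

Lemma le_tsum f g : asum f -> asum g -> (forall x, f x <= g x) ->
  tsum f <= tsum g.
Proof.
move=> sf sg fg; rewrite -subr_ge0 -tsumB//; apply: tsum_ge0 => x.
by rewrite subr_ge0.
Qed.

Lemma ler_norm_tsum f : asum f -> `|tsum f| <= tsum (fun x => `|f x|).
Proof.
move=> sf; rewrite ler_norml -tsumN ?asum_norm//.
rewrite !le_tsum ?asumN ?asum_norm// => x; first exact: ler_norm.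
by rewrite lerNl -normrN ler_norm.
Qed.

Lemma asum0 : asum (fun=> 0).
Proof. by rewrite /asum summableE esum1// => x _ /=; rewrite normr0. Qed.

Lemma tsum0 : tsum (fun _ : T => 0 : R) = 0.
Proof. by rewrite tsum_ge0E// esum1. Qed.

Lemma asum_sum (I : Type) (r : seq I) (F : I -> T -> R) :
  (forall i, asum (F i)) -> asum (fun x => \sum_(i <- r) F i x).
Proof.
move=> sF; elim: r => [|i r IH].
  by under eq_fun do rewrite big_nil; exact: asum0.
by under eq_fun do rewrite big_cons; exact: asumD.
Qed.

Lemma tsum_sum (I : Type) (r : seq I) (F : I -> T -> R) :
  (forall i, asum (F i)) ->
  tsum (fun x => \sum_(i <- r) F i x) = \sum_(i <- r) tsum (F i).
Proof.
move=> sF; elim: r => [|i r IH].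
  by under eq_fun do rewrite big_nil; rewrite big_nil tsum0.
under eq_fun do rewrite big_cons.
by rewrite tsumD// ?IH ?big_cons//; exact: asum_sum.
Qed.

(** The bound is uniform in [Y] so that [X] may be enlarged to a set of a
    prescribed shape, such as all outcomes with signals at most [n]. *)
Lemma asum_tail f e : (forall x, 0 <= f x) -> asum f -> 0 < e ->
  exists2 X : set T, finite_set X &
    forall Y : set T, X `<=` Y -> tsum (fun x => f x * (x \notin Y)%:R) <= e.
Proof.
move=> f0 sf e0.
have: ((tsum f - e)%:E < \esum_(x in [set: T]) (f x)%:E)%E.
  by rewrite esumEtsum// lte_fin ltrBlDr ltrDl.
move=> /ereal_sup_gt[_ [X [finX _] <-]] lX; exists X => // Y XY.
have fY0 x : 0 <= f x * (x \in Y)%:R by rewrite mulr_ge0.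
have sfY : asum (fun x => f x * (x \in Y)%:R).
  apply: le_asum sf => x; rewrite ger0_norm//.
  by case: (x \in Y); rewrite ?mulr1 ?mulr0.
rewrite (@eq_tsum _ (fun x => f x - f x * (x \in Y)%:R)); last first.
  by move=> x; case: (x \in Y) => /=; lra.
rewrite tsumB// lerBlDr addrC -lerBlDr -lee_fin (le_trans (ltW lX))//.
rewrite -esumEtsum//; apply: esum_ge; exists X; first by split.
apply: lee_fsum => // x Xx; rewrite lee_fin mem_set ?mulr1//; exact: XY.
Qed.

End AbsolutelyConvergentSums.

(** * Limits along a filter *)
Lemma cvg_le_bound (R : realType) (I : Type) (F : set_system I) (a : I -> R)
    (l M : R) : ProperFilter F ->
  a i @[i --> F] --> l -> (forall i, a i <= M) -> l <= M.
Proof.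
move=> FF al aM; rewrite -(cvg_lim _ al)//.
by apply: limr_le; [exact: cvgP al|exact: nearW].
Qed.

Lemma cvg_ge_bound (R : realType) (I : Type) (F : set_system I) (a : I -> R)
    (l M : R) : ProperFilter F ->
  a i @[i --> F] --> l -> (forall i, M <= a i) -> M <= l.
Proof.
move=> FF al aM; rewrite -(cvg_lim _ al)//.
by apply: limr_ge; [exact: cvgP al|exact: nearW].
Qed.

Section LimitsOfSums.
Variables (R : realType) (T : choiceType).
Implicit Types (f g h : T -> R).

Lemma esum_finite_support f (X : set T) : finite_set X ->
  (forall x, 0 <= f x) ->
  (\esum_(x in [set: T]) (f x * (x \in X)%:R)%:E =
   (\sum_(x <- finmap.enum_fset (fset_set X)) f x)%:E)%E.
Proof.
move=> finX f0; rewrite -sumEFin -(fsbig_finite _ (EFin \o f))//.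
rewrite -esum_fset//; last by move=> x _; rewrite /= lee_fin.
rewrite [RHS]esum_mkcond; apply: eq_esum => x _.
by case: ifP => _; rewrite ?mulr1 ?mulr0.
Qed.

Lemma asum_finite_support f (X : set T) : finite_set X ->
  (forall x, 0 <= f x) -> asum (fun x => f x * (x \in X)%:R).
Proof.
move=> finX f0; apply/asum_ge0P; first by move=> x; rewrite mulr_ge0.
by rewrite esum_finite_support.
Qed.

Lemma tsum_finite_support f (X : set T) : finite_set X ->
  (forall x, 0 <= f x) -> tsum (fun x => f x * (x \in X)%:R) =
   \sum_(x <- finmap.enum_fset (fset_set X)) f x.
Proof.
move=> finX f0; rewrite tsum_ge0E; first by rewrite esum_finite_support.
by move=> x; rewrite mulr_ge0.
Qed.

Lemma cvg_finite_sum (I : Type) (F : set_system I) (r : seq T)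
    (f : I -> T -> R) f0 : Filter F ->
  (forall x, f i x @[i --> F] --> f0 x) ->
  \sum_(x <- r) f i x @[i --> F] --> \sum_(x <- r) f0 x.
Proof.
move=> FF ff0; elim: r => [|x r IH].
  by under eq_fun do rewrite big_nil; rewrite big_nil; exact: cvg_cst.
under eq_fun do rewrite big_cons; rewrite big_cons; exact: cvgD.
Qed.

(** Dominated convergence for sums. Almost all of the mass of the dominating
    family lies on a finite set [X], where convergence is that of a finite sum;
    off [X] the terms differ by at most twice the tail. *)
Lemma cvg_tsum (I : Type) (F : set_system I) (f : I -> T -> R) f0 h :
  ProperFilter F -> (forall i x, `|f i x| <= h x) -> asum h ->
  (forall x, f i x @[i --> F] --> f0 x) ->
  tsum (f i) @[i --> F] --> tsum f0.
Proof.
move=> FF fh sh ff0.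
have f0h x : `|f0 x| <= h x.
  by apply: cvg_le_bound (cvg_norm (ff0 x)) _ => i; exact: fh.
have h0 x : 0 <= h x by exact: le_trans (normr_ge0 _) (f0h x).
apply/cvgrPdist_le => e e0.
have [|X finX /(_ X (@subset_refl _ X)) tailX] :=
  @asum_tail R T h (e / 4) h0 sh.
  by rewrite divr_gt0.
have sf i : asum (f i) by exact: le_asum (fh i) sh.
have sf0 : asum f0 by exact: le_asum f0h sh.
have cvg0 : \sum_(x <- finmap.enum_fset (fset_set X)) `|f0 x - f i x|
    @[i --> F] --> \sum_(x <- finmap.enum_fset (fset_set X)) (0 : R).
  apply: cvg_finite_sum => x; rewrite -(normr0 R) -(subrr (f0 x)).
  by apply: cvg_norm; apply: cvgB => //; exact: cvg_cst.
rewrite big1// in cvg0.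
have e2 : 0 < e / 2 by rewrite divr_gt0.
have /cvgrPdist_le /(_ _ e2) := cvg0.
apply: filterS => i; rewrite sub0r normrN => small.
rewrite -tsumB// (le_trans (ler_norm_tsum _))//; first exact: asumB.
have d0 x : 0 <= `|f0 x - f i x| by [].
have sX := asum_finite_support finX d0.
have st : asum (fun x => 2 * (h x * (x \notin X)%:R)).
  apply: asumZ; apply: le_asum sh => x; rewrite ger0_norm ?mulr_ge0//.
  by case: (x \notin X); rewrite ?mulr1 ?mulr0.
apply: (@le_trans _ _ (tsum (fun x => `|f0 x - f i x| * (x \in X)%:R +
    2 * (h x * (x \notin X)%:R)))).
  apply: le_tsum; [by apply/asum_norm/asumB|exact: asumD|move=> x].
  case: (x \in X) => /=; first by rewrite mulr1 !mulr0 addr0.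
  rewrite mulr0 add0r mulr1 (le_trans (ler_normB _ _))//.
  by have := f0h x; have := fh i x; lra.
rewrite tsumD// tsum_finite_support// tsumZ; last first.
  apply: le_asum sh => x; rewrite ger0_norm ?mulr_ge0//.
  by case: (x \notin X); rewrite ?mulr1 ?mulr0.
by have := ler_norm (\sum_(x <- finmap.enum_fset (fset_set X)) `|f0 x - f i x|);
  lra.
Qed.

(** Fatou: mass can be lost in a pointwise limit, never gained. *)
Lemma le_tsum_lim (I : Type) (F : set_system I) (f : I -> T -> R) f0 (M : R) :
  ProperFilter F -> (forall i x, 0 <= f i x) -> (forall i, asum (f i)) ->
  (forall i, tsum (f i) <= M) -> (forall x, f i x @[i --> F] --> f0 x) ->
  [/\ forall x, 0 <= f0 x, asum f0 & tsum f0 <= M].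
Proof.
move=> FF fp sf fM ff0.
have f00 x : 0 <= f0 x.
  by apply: cvg_ge_bound (ff0 x) _ => i; exact: fp.
have esumM : (\esum_(x in [set: T]) (f0 x)%:E <= M%:E)%E.
  apply: ge_ereal_sup => _ [X [finX _] <-].
  rewrite fsbig_finite//= sumEFin lee_fin.
  apply: cvg_le_bound
    (@cvg_finite_sum _ _ (finmap.enum_fset (fset_set X)) _ _ _ ff0) _ => i.
  rewrite -tsum_finite_support//.
  apply: le_trans (fM i); apply: le_tsum => //; first exact: asum_finite_support.
  by move=> x; case: (x \in X); rewrite ?mulr1 ?mulr0.
have sf0 : asum f0.
  apply/asum_ge0P => //; rewrite ge0_fin_numE.
    exact: le_lt_trans esumM (ltry _).
  by apply: esum_ge0 => x _; rewrite lee_fin.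
by split => //; rewrite -lee_fin -esumEtsum.
Qed.

End LimitsOfSums.

(** Limits along one fixed ultrafilter replace extraction of subsequences: all
    the coordinates of a family of bounded sequences converge at once. *)
Lemma ultra_bounded_cvg (R : realType) (I : Type) (U : set_system I)
    (a : I -> R) (B : R) : UltraFilter U -> (forall i, `|a i| <= B) ->
  exists l : R, a i @[i --> U] --> l.
Proof.
move=> UU aB; have := @segment_compact R (- B) B.
rewrite compact_ultra => /(_ (a @ U)).
have UaU : UltraFilter (a @ U).
  split=> [|G PG sG]; first exact: fmap_proper_filter.
  apply/seteqP; split=> // A GA.
  have [//|UnA] := in_ultra_setVsetC (a @^-1` A) UU.
  have /sG GnA : (a @ U) (~` A) by [].
  by have [x []] := filter_ex (filterI GA GnA).
case=> //; last by move=> l [_ cl]; exists l.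
by apply: nearW => i /=; rewrite in_itv/= -ler_norml.
Qed.

(** * Exchanging sums along one coordinate *)

(** [coord] and [upd] read and overwrite one natural-number coordinate
    of [x]. Treating the coordinate abstractly gives the garblings of both
    players from a single development. *)
Section Tonelli.
Variables (R : realType) (T : choiceType).
Variables (coord : T -> nat) (upd : T -> nat -> T).
Hypotheses (coord_upd : forall x c, coord (upd x c) = c)
  (upd_coord : forall x, upd x (coord x) = x)
  (upd_upd : forall x c c', upd (upd x c) c' = upd x c').

(** The map [(x, c) |-> (upd x c, coord x)], which swaps [c] with the
    coordinate of [x], is an involution. *)
Lemma esum_exchange_coordinate (F : T -> nat -> R) :
  (forall x c, 0 <= F x c) ->
  (\esum_(x in [set: T]) \esum_(c in [set: nat]) (F x c)%:E =
   \esum_(x in [set: T]) \esum_(c in [set: nat]) (F (upd x c) (coord x))%:E)%E.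
Proof.
move=> F0.
rewrite esum_esum; last by move=> x c _ _; rewrite lee_fin.
rewrite esum_esum; last by move=> x c _ _; rewrite lee_fin.
have -> : [set: T] `*`` (fun=> [set: nat]) = [set: T * nat].
  by apply/seteqP; split.
rewrite (@reindex_esum _ _ _ [set: T * nat] [set: T * nat]
  (fun xc => (upd xc.1 xc.2, coord xc.1)))//.
split => //.
- move=> [x c] [y d] _ _ /= [exy rxy].
  have cd : c = d by rewrite -(coord_upd x c) exy coord_upd.
  by congr (_, _) => //; rewrite -(upd_coord x) -(upd_coord y) rxy
    -(upd_upd x c) -(upd_upd y d) exy.
- move=> [x c] _; exists (upd x c, coord x) => //=.
  by rewrite coord_upd upd_upd upd_coord.
Qed.

Lemma tsum_exchange_coordinate (F : T -> nat -> R) :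
  (forall x c, 0 <= F x c) -> (forall x, asum (F x)) ->
  asum (fun x => tsum (F x)) ->
  [/\ forall x, asum (fun c => F (upd x c) (coord x)),
      asum (fun x => tsum (fun c => F (upd x c) (coord x))) &
      tsum (fun x => tsum (fun c => F (upd x c) (coord x))) =
      tsum (fun x => tsum (F x))].
Proof.
move=> F0 sF stF.
have tF0 x : 0 <= tsum (F x) by exact: tsum_ge0.
have total : (\esum_(x in [set: T]) \esum_(c in [set: nat])
    (F (upd x c) (coord x))%:E = (tsum (fun x => tsum (F x)))%:E)%E.
  rewrite -esum_exchange_coordinate// -esumEtsum//.
  by apply: eq_esum => x _; rewrite esumEtsum.
have inner0 x : (0 <= \esum_(c in [set: nat]) (F (upd x c) (coord x))%:E)%E.
  by apply: esum_ge0 => c _; rewrite lee_fin.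
have sF' x : asum (fun c => F (upd x c) (coord x)).
  apply/asum_ge0P => //; rewrite ge0_fin_numE//.
  have : (\esum_(y in [set x]) \esum_(c in [set: nat])
    (F (upd y c) (coord y))%:E < +oo)%E.
    apply: le_lt_trans (ltry (tsum (fun x => tsum (F x)))).
    rewrite -total [leLHS]esum_mkcond; apply: le_esum => y _.
    by case: ifP.
  by rewrite esum_set1.
have totalE : (\esum_(x in [set: T])
    (tsum (fun c => F (upd x c) (coord x)))%:E = (tsum (fun x => tsum (F x)))%:E)%E.
  by rewrite -total; apply: eq_esum => x _; rewrite esumEtsum.
have tF'0 x : 0 <= tsum (fun c => F (upd x c) (coord x)) by exact: tsum_ge0.
split=> //; first by apply/asum_ge0P => //; rewrite totalE.
by rewrite tsum_ge0E// totalE.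
Qed.

End Tonelli.

(** * A minimax theorem *)

(** [X] will be a type of strategies or of pairs of garblings, on which the
    [f ^~ i] are affine functionals; [f_convex] is the convexity of their joint
    range. *)
Section Minimax.
Variables (R : realType) (X : Type) (T : finType) (f : X -> T -> R) (x0 : X).
Variables (B w : R).
Hypothesis fB : forall x i, `|f x i| <= B.
Hypothesis f_convex : forall x y s, 0 <= s <= 1 ->
  exists z, forall i, f z i = (1 - s) * f x i + s * f y i.
Hypothesis f_le : forall x, exists i, f x i <= w.

Let pospart (y : R) := Num.max y 0.

Let pospart_ge0 y : 0 <= pospart y. Proof. by rewrite le_max lexx orbT. Qed.

(* The smoothness of the squared positive part behind the first-order
   argument: no second-order term larger than [h ^+ 2], even across the kink. *)
Let pospart_quadratic a h :
  pospart (a - h) ^+ 2 <= pospart a ^+ 2 - 2 * pospart a * h + h ^+ 2.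
Proof.
by rewrite /pospart; case: (leP (a - h) 0); case: (leP a 0) => ? ?; nra.
Qed.

Let pospartM y : pospart y * y = pospart y ^+ 2.
Proof.
by rewrite /pospart; case: (leP y 0) => _; rewrite ?mul0r ?expr2 ?mul0r.
Qed.

(** Let [t = w + e] and let [Phi x] be the sum of the squares of the positive
    parts of [t - f x i]. As some [f x i] is at most [w], [Phi] is at least
    [e ^+ 2]. At a near-minimizer [x1] of [Phi], moving towards any [x] cannot
    decrease [Phi] much, so the weights [a i = pospart (t - f x1 i)], which are
    half the opposite of the slopes of [Phi] at [x1], satisfy
    [\sum_i a i * (f x i - f x1 i) <= m], where [m = inf Phi], once the
    precision is fine enough. Since [\sum_i a i * (t - f x1 i) = Phi x1 >= m], this says
    [\sum_i a i * f x i <= t * \sum_i a i]; normalize. *)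
Lemma approximate_minimax e : 0 < e ->
  exists2 l : T -> R, (forall i, 0 <= l i) /\ \sum_i l i = 1 &
    forall x, \sum_i l i * f x i <= w + e.
Proof.
move=> e0; set t := w + e.
pose Phi x := \sum_i pospart (t - f x i) ^+ 2.
have Phi_ge x : e ^+ 2 <= Phi x.
  have [i fi] := f_le x; rewrite /Phi (bigD1 i)//= ler_wpDr//.
    by apply: sumr_ge0 => j _; exact: sqr_ge0.
  rewrite ler_sqr ?nnegrE ?(ltW e0)// /pospart le_max; apply/orP; left.
  by rewrite /t; lra.
have infP : has_inf (range Phi).
  by split; [exists (Phi x0), x0|exists (e ^+ 2) => _ [x _ <-]].
pose m := inf (range Phi).
have m_gt0 : 0 < m.
  apply: (@lt_le_trans _ _ (e ^+ 2)); first exact: exprn_gt0.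
  by apply: lb_le_inf; [case: infP|move=> _ [x _ <-]].
have m_le x : m <= Phi x by apply: ge_inf; [case: infP|exists x].
(* [Q] bounds the quadratic term; the step [s] and the precision [s * m] are
   such that the quadratic term and the defect of [x1] are each at most
   [s * m]. *)
pose Q := \sum_(i : T) (2 * B) ^+ 2 + 1.
have Q_gt0 : 0 < Q.
  by rewrite ltr_wpDl// sumr_ge0// => i _; exact: sqr_ge0.
pose s := Num.min 1 (m / Q).
have s_gt0 : 0 < s by rewrite lt_min ltr01 divr_gt0.
have s_le1 : s <= 1 by rewrite ge_min lexx.
have sQ : s * Q <= m by rewrite -ler_pdivlMr// ge_min lexx orbT.
have [_ [x1 _ <-] Phi1] : exists2 r, range Phi r & r < m + s * m.
  by apply: inf_adherent => //; exact: mulr_gt0.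
pose a i := pospart (t - f x1 i).
have a0 i : 0 <= a i by exact: pospart_ge0.
have first_order x : \sum_i a i * (f x i - f x1 i) <= m.
  have [|z zE] := @f_convex x1 x s; first by rewrite ltW.
  have Phiz : Phi z <= Phi x1 - 2 * s * (\sum_i a i * (f x i - f x1 i)) +
      s ^+ 2 * Q.
    apply: (@le_trans _ _ (\sum_i (pospart (t - f x1 i) ^+ 2 -
        2 * s * (a i * (f x i - f x1 i)) + s ^+ 2 * (2 * B) ^+ 2))).
      apply: ler_sum => i _; rewrite zE.
      have -> : t - ((1 - s) * f x1 i + s * f x i) =
        (t - f x1 i) - s * (f x i - f x1 i) by lra.
      apply: le_trans (pospart_quadratic _ _) _; rewrite -/(a i).
      have : (f x i - f x1 i) ^+ 2 <= (2 * B) ^+ 2.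
        have := fB x i; have := fB x1 i; rewrite !ler_norml.
        by move=> /andP[? ?] /andP[? ?]; nra.
      have : 0 <= s ^+ 2 by exact: sqr_ge0.
      by nra.
    rewrite big_split/= sumrB -mulr_sumr -[X in _ + X <= _]mulr_sumr.
    rewrite -/(Phi x1) lerD2l /Q mulrDr mulr1.
    by rewrite lerDl sqr_ge0.
  have := m_le z.
  set S := \sum_i _ in Phiz * => mz.
  have : s * S <= s * m by nra.
  by rewrite ler_pM2l.
have sum_a2 : \sum_i a i * (t - f x1 i) = Phi x1.
  by apply: eq_bigr => i _; rewrite /a pospartM.
pose A := \sum_i a i.
have below x : \sum_i a i * f x i <= t * A.
  have -> : \sum_i a i * f x i =
      \sum_i a i * (f x i - f x1 i) - \sum_i a i * (t - f x1 i) + t * A.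
    rewrite mulr_sumr -sumrB -big_split/=; apply: eq_bigr => i _; lra.
  by rewrite sum_a2; have := first_order x; have := m_le x1; lra.
have A_gt0 : 0 < A.
  have A0 : 0 <= A by exact: sumr_ge0.
  rewrite lt_neqAle A0 andbT eq_sym; apply/eqP => /eqP.
  rewrite psumr_eq0// => /allP az.
  have : Phi x1 = 0.
    apply: big1 => i _; have /eqP := az i (mem_index_enum i).
    by rewrite /a => ->; rewrite expr0n.
  by have := m_le x1; lra.
exists (fun i => a i / A).
  split=> [i|]; first by rewrite divr_ge0// ltW.
  by rewrite -mulr_suml divff// gt_eqF.
move=> x; under eq_bigr do rewrite mulrAC.
by rewrite -mulr_suml ler_pdivrMr.
Qed.

(** The weights of the approximate statement lie in a compact simplex: take
    their limit as the error tends to [0]. *)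
Lemma minimax :
  exists2 l : T -> R, (forall i, 0 <= l i) /\ \sum_i l i = 1 &
    forall x, \sum_i l i * f x i <= w.
Proof.
have /choice[l lP] (n : nat) : exists l : T -> R,
    [/\ forall i, 0 <= l i, \sum_i l i = 1 &
        forall x, \sum_i l i * f x i <= w + harmonic n].
  have n0 : 0 < harmonic n :> R by rewrite /= invr_gt0.
  by have [l [l0 l1] lw] := approximate_minimax n0; exists l.
have [U [UU ooU]] := @ultraFilterLemma nat \oo _.
have PU : ProperFilter U by exact: ultra_proper.
have l_le1 n i : `|l n i| <= 1.
  have [l0 <- _] := lP n; rewrite ger0_norm// (bigD1 i)//= lerDl.
  by apply: sumr_ge0.
have /choice[l' l'P] (i : T) : exists r : R, l n i @[n --> U] --> r.
  exact: ultra_bounded_cvg (l_le1 ^~ i).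
exists l'.
  split=> [i|].
    by apply: cvg_ge_bound (l'P i) _ => n; have [] := lP n.
  have := @cvg_finite_sum _ _ _ _ (index_enum T) _ _ _ l'P.
  move=> /(_ _) cvg1; apply/eqP; rewrite eq_le.
  by rewrite (cvg_le_bound PU cvg1) ?(cvg_ge_bound PU cvg1)// => n;
    have [_ ->] := lP n.
move=> x.
have cvgx : \sum_i l n i * f x i - harmonic n @[n --> U] -->
    \sum_i l' i * f x i - 0.
  apply: cvgB; last exact: cvg_trans (cvg_app _ ooU) cvg_harmonic.
  by apply: cvg_finite_sum => i; apply: cvgM => //; exact: cvg_cst.
rewrite -[leLHS]subr0; apply: cvg_le_bound cvgx _ => n.
by have [_ _] := lP n; move/(_ x); lra.
Qed.

End Minimax.

(** * Expectations *)
Section Expectation.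
Variables (R : realType) (T : choiceType).
Implicit Types (p : prob R T) (h : T -> R).

Definition bnd h := exists B, forall x, `|h x| <= B.

Lemma bnd_le h (B : R) : (forall x, `|h x| <= B) -> bnd h.
Proof. by exists B. Qed.

Lemma bnd_cst (r : R) : bnd (fun=> r).
Proof. by exists `|r|. Qed.

Lemma bndD h h' : bnd h -> bnd h' -> bnd (fun x => h x + h' x).
Proof.
move=> [B hB] [B' hB']; exists (B + B') => x.
by rewrite (le_trans (ler_normD _ _))// lerD.
Qed.

Lemma bndM h h' : bnd h -> bnd h' -> bnd (fun x => h x * h' x).
Proof.
by move=> [B hB] [B' hB']; exists (B * B') => x; rewrite normrM ler_pM.
Qed.

Lemma bndZ (r : R) h : bnd h -> bnd (fun x => r * h x).
Proof. by apply: bndM; exact: bnd_cst. Qed.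

Lemma bnd_indicator (b : T -> bool) : bnd (fun x => (b x)%:R).
Proof. by exists 1 => x; case: (b x); rewrite ?normr1 ?normr0. Qed.

Lemma bnd_sum (I : Type) (r : seq I) (F : I -> T -> R) :
  (forall i, bnd (F i)) -> bnd (fun x => \sum_(i <- r) F i x).
Proof.
move=> bF; elim: r => [|i r IH].
  by under eq_fun do rewrite big_nil; exact: bnd_cst.
by under eq_fun do rewrite big_cons; exact: bndD.
Qed.

Lemma asum_pmf p : asum p.
Proof. by apply/asum_ge0P; [exact: pmf_ge0|rewrite pmf_sum1]. Qed.

Lemma tsum_pmf p : tsum p = 1.
Proof. by rewrite tsum_ge0E ?pmf_sum1//; exact: pmf_ge0. Qed.

Definition mkprob (f : T -> R) (f0 : forall x, 0 <= f x) (sf : asum f)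
    (f1 : tsum f = 1) : prob R T :=
  Prob f0 (etrans (esumEtsum f0 sf) (congr1 EFin f1)).

Lemma pmf_le1 p x : p x <= 1.
Proof.
rewrite -(tsum_pmf p).
have X1 : finite_set [set x] by exact: finite_set1.
have := tsum_finite_support X1 (pmf_ge0 p).
rewrite fset_set1 finmap.big_seq_fset1 => <-.
apply: le_tsum; [exact/asum_finite_support/pmf_ge0|exact: asum_pmf|move=> y].
by case: (y \in _); rewrite ?mulr1 ?mulr0 ?pmf_ge0.
Qed.

Definition Ex p h := tsum (fun x => p x * h x).

Lemma asum_Ex p h : bnd h -> asum (fun x => p x * h x).
Proof.
move=> [B hB]; apply: (@le_asum _ _ _ (fun x => B * p x)).
  by move=> x; rewrite normrM (ger0_norm (pmf_ge0 p x)) mulrC ler_wpM2r ?pmf_ge0.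
exact/asumZ/asum_pmf.
Qed.

Lemma eq_Ex p h h' : h =1 h' -> Ex p h = Ex p h'.
Proof. by move/funext ->. Qed.

Lemma ExD p h h' : bnd h -> bnd h' ->
  Ex p (fun x => h x + h' x) = Ex p h + Ex p h'.
Proof.
move=> bh bh'; rewrite /Ex -tsumD; [|exact: asum_Ex|exact: asum_Ex].
by apply: eq_tsum => x; rewrite mulrDr.
Qed.

Lemma ExZ p (r : R) h : bnd h -> Ex p (fun x => r * h x) = r * Ex p h.
Proof.
move=> bh; rewrite /Ex -tsumZ; last exact: asum_Ex.
by apply: eq_tsum => x; rewrite mulrCA.
Qed.

Lemma ExB p h h' : bnd h -> bnd h' ->
  Ex p (fun x => h x - h' x) = Ex p h - Ex p h'.
Proof.
move=> bh bh'; rewrite /Ex -tsumB; [|exact: asum_Ex|exact: asum_Ex].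
by apply: eq_tsum => x; rewrite mulrBr.
Qed.

Lemma Ex_sum p (I : Type) (r : seq I) (F : I -> T -> R) :
  (forall i, bnd (F i)) ->
  Ex p (fun x => \sum_(i <- r) F i x) = \sum_(i <- r) Ex p (F i).
Proof.
move=> bF; rewrite /Ex -tsum_sum; last by move=> i; exact: asum_Ex.
by apply: eq_tsum => x; rewrite mulr_sumr.
Qed.

Lemma Ex_cst p (r : R) : Ex p (fun=> r) = r.
Proof.
rewrite /Ex (@eq_tsum _ _ _ (fun x => r * p x)); last by move=> x; rewrite mulrC.
by rewrite tsumZ ?tsum_pmf ?mulr1//; exact: asum_pmf.
Qed.

Lemma le_Ex p h h' : bnd h -> bnd h' -> (forall x, h x <= h' x) ->
  Ex p h <= Ex p h'.
Proof.
move=> bh bh' hh'; apply: le_tsum; [exact: asum_Ex|exact: asum_Ex|move=> x].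
by rewrite ler_wpM2l ?pmf_ge0.
Qed.

Lemma Ex_ge0 p h : (forall x, 0 <= h x) -> 0 <= Ex p h.
Proof. by move=> h0; apply: tsum_ge0 => x; rewrite mulr_ge0 ?pmf_ge0. Qed.

Lemma ler_norm_Ex p h (B : R) : (forall x, `|h x| <= B) -> `|Ex p h| <= B.
Proof.
move=> hB; have bh := bnd_le hB.
rewrite ler_norml -(Ex_cst p (- B)) -{2}(Ex_cst p B).
by rewrite !le_Ex//; do ?[exact: bnd_cst]; move=> x; have := hB x;
  rewrite ler_norml => /andP[].
Qed.

Section Mixture.
Variables (s : R) (p p' : prob R T).
Hypothesis s01 : 0 <= s <= 1.

Let mix_fun x := (1 - s) * p x + s * p' x.

Let mix_ge0 x : 0 <= mix_fun x.
Proof.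
by have [s0 s1] := andP s01; rewrite addr_ge0// mulr_ge0 ?pmf_ge0// subr_ge0.
Qed.

Let asum_mix : asum mix_fun.
Proof. by apply: asumD; exact/asumZ/asum_pmf. Qed.

Let tsum_mix : tsum mix_fun = 1.
Proof.
rewrite tsumD; do ?[exact/asumZ/asum_pmf].
by rewrite !tsumZ ?tsum_pmf; do ?[exact: asum_pmf]; lra.
Qed.

Definition mix := mkprob mix_ge0 asum_mix tsum_mix.

End Mixture.

Lemma Ex_mix s p p' (s01 : 0 <= s <= 1) h : bnd h ->
  Ex (mix p p' s01) h = (1 - s) * Ex p h + s * Ex p' h.
Proof.
move=> bh; rewrite /Ex -!tsumZ; do ?[exact: asum_Ex].
rewrite -tsumD; do ?[exact/asumZ/asum_Ex].
by apply: eq_tsum => x /=; rewrite mulrDl !mulrA.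
Qed.

Lemma tsum_point a (f : T -> R) : (forall x, 0 <= f x) ->
  asum (fun x => (x == a)%:R * f x) /\ tsum (fun x => (x == a)%:R * f x) = f a.
Proof.
move=> f0; have finA : finite_set [set a] by exact: finite_set1.
have -> : (fun x => (x == a)%:R * f x) = (fun x => f x * (x \in [set a])%:R).
  apply/funext => x; rewrite mulrC; congr (_ * _%:R).
  by case: eqP => [->|xa]; [rewrite mem_set|rewrite memNset].
split; first exact: asum_finite_support.
by rewrite tsum_finite_support// fset_set1 finmap.big_seq_fset1.
Qed.

Definition point (a : T) : prob R T :=
  let one := tsum_point a (fun=> ler01) in
  mkprob (fun x => mulr_ge0 (ler0n R (x == a)) ler01) one.1 one.2.

Lemma Ex_point a h : Ex (point a) h = h a.
Proof.
rewrite /Ex (@eq_tsum _ _ _ (fun x => (x == a)%:R * `|h x| -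
   (x == a)%:R * (`|h x| - h x))); last first.
  by move=> x /=; rewrite mulr1 -mulrBr opprB addrC subrK.
have [s1 t1] := @tsum_point a (fun x => `|h x|) (fun x => normr_ge0 _).
have h0 x : 0 <= `|h x| - h x by rewrite subr_ge0 ler_norm.
have [s2 t2] := @tsum_point a _ h0.
by rewrite tsumB// t1 t2 opprB addrC subrK.
Qed.

End Expectation.

Lemma bnd_pmf (R : realType) (S : Type) (A T : choiceType) (p : S -> prob R A)
  (a : A) (f : T -> S) : bnd (fun x => p (f x) a).
Proof. by exists 1 => x; rewrite ger0_norm ?pmf_ge0 ?pmf_le1. Qed.

Section FiniteProbability.
Variables (R : realType) (A : finType).

Lemma tsum_finType (f : A -> R) : asum f /\ tsum f = \sum_a f a.
Proof.
have finT : finite_set [set: A] by exact: finite_finset.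
have sf0 (g : A -> R) : (forall a, 0 <= g a) -> asum g /\ tsum g = \sum_a g a.
  move=> g0.
  have -> : g = (fun x => g x * (x \in [set: A])%:R).
    by apply/funext => x; rewrite mem_set ?mulr1.
  split; first exact: asum_finite_support.
  rewrite tsum_finite_support//=.
  under [RHS]eq_bigr do rewrite mem_set// mulr1.
  rewrite -big_enum; apply: perm_big; apply: uniq_perm.
  - exact: finmap.fset_uniq.
  - exact: enum_uniq.
  - by move=> a; rewrite mem_enum in_fset_set// mem_set.
have sf : asum f by apply: le_asum (sf0 (fun a => `|f a|) _).1.
split=> //; rewrite tsum_posneg// !(sf0 _ _).2;
  do ?[exact: funrpos_ge0|exact: funrneg_ge0].
by rewrite -sumrB; apply: eq_bigr => a _; rewrite -{3}(funrposBneg f).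
Qed.

Lemma sum_pmf (p : prob R A) : \sum_a p a = 1.
Proof. by rewrite -(tsum_finType p).2 tsum_pmf. Qed.

Definition fprob (f : A -> R) (f0 : forall a, 0 <= f a) (f1 : \sum_a f a = 1) :
  prob R A := mkprob f0 (tsum_finType f).1 (etrans (tsum_finType f).2 f1).

End FiniteProbability.

(** * Garblings *)

(** The kernel [q] redraws one coordinate of the outcome from its current
    value. *)
Section Garbling.
Variables (R : realType) (T : choiceType).
Variables (coord : T -> nat) (upd : T -> nat -> T).
Hypotheses (coord_upd : forall x c, coord (upd x c) = c)
  (upd_coord : forall x, upd x (coord x) = x)
  (upd_upd : forall x c c', upd (upd x c) c' = upd x c').
Variables (u : prob R T) (q : garbling R).

Definition garble x := tsum (fun c => u (upd x c) * q c (coord x)).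

Let garble_ge0 x : 0 <= garble x.
Proof. by apply: tsum_ge0 => c; rewrite mulr_ge0 ?pmf_ge0. Qed.

(* Tonelli for the law of (outcome, new signal), weighted by [h >= 0]. With
   [h = 1] it says that [garble] is a probability. *)
Let garble_core h : (forall x, 0 <= h x) -> bnd h ->
  [/\ forall x, asum (fun c => u (upd x c) * q c (coord x) * h x),
      asum (fun x => tsum (fun c => u (upd x c) * q c (coord x) * h x)) &
      tsum (fun x => tsum (fun c => u (upd x c) * q c (coord x) * h x)) =
      Ex u (fun x => Ex (q (coord x)) (fun c => h (upd x c)))].
Proof.
move=> h0 [B hB].
pose F x c := u x * (q (coord x) c * h (upd x c)).
have bh x : bnd (fun c => h (upd x c)) by exists B.
have F0 x c : 0 <= F x c by rewrite !mulr_ge0 ?pmf_ge0.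
have sF x : asum (F x) by apply: asumZ; exact: asum_Ex.
have tF x : tsum (F x) = u x * Ex (q (coord x)) (fun c => h (upd x c)).
  by rewrite tsumZ//; exact: asum_Ex.
have stF : asum (fun x => tsum (F x)).
  under eq_fun do rewrite tF.
  by apply: asum_Ex; exists B => x; exact: ler_norm_Ex.
have [s1 s2 s3] := tsum_exchange_coordinate coord_upd upd_coord upd_upd F0 sF stF.
have Fwr x : (fun c => F (upd x c) (coord x)) =
    (fun c => u (upd x c) * q c (coord x) * h x).
  by apply/funext => c; rewrite /F coord_upd upd_upd upd_coord mulrA.
split.
- by move=> x; rewrite -Fwr.
- by under eq_fun do rewrite -Fwr.
- by under eq_tsum do rewrite -Fwr; rewrite s3; apply: eq_tsum => x; exact: tF.
Qed.

Let garble1_core : [/\ forall x, asum (fun c => u (upd x c) * q c (coord x)),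
   asum garble & tsum garble = 1].
Proof.
have [] := @garble_core (fun=> 1) (fun=> ler01) (bnd_cst _ _).
have mul1 x : (fun c => u (upd x c) * q c (coord x) * 1) =
    (fun c => u (upd x c) * q c (coord x)).
  by apply/funext => c; rewrite mulr1.
have garble1 : (fun x => tsum (fun c => u (upd x c) * q c (coord x) * 1)) = garble.
  by apply/funext => x; rewrite mul1.
rewrite garble1 => s1 s2 ->; split=> //; first by move=> x; rewrite -mul1.
by rewrite -[RHS](Ex_cst u 1); apply: eq_Ex => x; exact: Ex_cst.
Qed.

Lemma asum_garble_row x : asum (fun c => u (upd x c) * q c (coord x)).
Proof. by have [] := garble1_core. Qed.

Definition garbled : prob R T :=
  let: And3 _ s1 t1 := garble1_core in mkprob garble_ge0 s1 t1.

Lemma garbledE x : garbled x = garble x.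
Proof. by rewrite /garbled; case: garble1_core. Qed.

Let Ex_garbled_ge0 h : (forall x, 0 <= h x) -> bnd h ->
  Ex garbled h = Ex u (fun x => Ex (q (coord x)) (fun c => h (upd x c))).
Proof.
move=> h0 bh; have [_ _ <-] := garble_core h0 bh.
apply: eq_tsum => x; rewrite garbledE mulrC -tsumZ; last exact: asum_garble_row.
by apply: eq_tsum => c; rewrite mulrC.
Qed.

(** Garbling the structure amounts to averaging the integrand over the new
    signal. The nonnegative case extends to bounded [h] by adding a constant. *)
Lemma Ex_garbled h : bnd h ->
  Ex garbled h = Ex u (fun x => Ex (q (coord x)) (fun c => h (upd x c))).
Proof.
move=> bh; have [B hB] := bh.
have B0 x : 0 <= h x + B by have := hB x; rewrite ler_norml => /andP[]; lra.
have bB (S : choiceType) : bnd (fun _ : S => B) by exact: bnd_cst.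
apply: (addIr B); have := Ex_garbled_ge0 B0 (bndD bh (bB _)).
rewrite ExD// Ex_cst => ->; rewrite -[X in _ + X](Ex_cst u B) -ExD//; last first.
  by exists B => x; exact: ler_norm_Ex.
apply: eq_Ex => x; rewrite ExD ?Ex_cst//.
by exists B.
Qed.

End Garbling.

Section OutcomeGarblings.
Variables (R : realType) (K : finType).
Local Notation T := (outcome K).

Definition signal1 (x : T) : nat := x.1.2.
Definition upd1 (x : T) (c : nat) : T := (x.1.1, c, x.2).
Definition signal2 (x : T) : nat := x.2.
Definition upd2 (x : T) (d : nat) : T := (x.1, d).

Let coord_upd1 x c : signal1 (upd1 x c) = c. Proof. by []. Qed.
Let upd_coord1 x : upd1 x (signal1 x) = x. Proof. by case: x => [[]]. Qed.
Let upd_upd1 x c c' : upd1 (upd1 x c) c' = upd1 x c'. Proof. by []. Qed.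
Let coord_upd2 x c : signal2 (upd2 x c) = c. Proof. by []. Qed.
Let upd_coord2 x : upd2 x (signal2 x) = x. Proof. by case: x. Qed.
Let upd_upd2 x c c' : upd2 (upd2 x c) c' = upd2 x c'. Proof. by []. Qed.

Implicit Types (u v : info R K) (q : garbling R).

Definition garbled1 q u : info R K := garbled coord_upd1 upd_coord1 upd_upd1 u q.
Definition garbled2 u q : info R K := garbled coord_upd2 upd_coord2 upd_upd2 u q.

Lemma garble1E q u : garble1 q u = garbled1 q u.
Proof. by apply/funext => -[[k c] d]; rewrite garbledE. Qed.

Lemma garble2E u q : garble2 u q = garbled2 u q.
Proof. by apply/funext => -[[k c] d]; rewrite garbledE. Qed.

Lemma Ex_garbled1 q u h : bnd h -> Ex (garbled1 q u) h =
  Ex u (fun x => Ex (q x.1.2) (fun c => h (x.1.1, c, x.2))).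
Proof. exact: Ex_garbled. Qed.

Lemma Ex_garbled2 u q h : bnd h -> Ex (garbled2 u q) h =
  Ex u (fun x => Ex (q x.2) (fun d => h (x.1, d))).
Proof. exact: Ex_garbled. Qed.

Lemma Ex_diff_le_tv (p p' : info R K) h : (forall x, `|h x| <= 1) ->
  Ex p h - Ex p' h <= tv_dist p p'.
Proof.
move=> h1; have bh := bnd_le h1.
rewrite /Ex -tsumB; do ?[exact: asum_Ex].
have sB : asum (fun x => p x - p' x) by apply: asumB; exact: asum_pmf.
apply: le_tsum; [by apply: asumB; exact: asum_Ex|exact: asum_norm|move=> x].
rewrite -mulrBl (le_trans (ler_norm _))// normrM.
by rewrite ler_piMr.
Qed.

Lemma tv_distC (a b : T -> R) : tv_dist a b = tv_dist b a.
Proof. by apply: eq_tsum => x; rewrite distrC. Qed.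

End OutcomeGarblings.

Section Payoffs.
Variables (R : realType) (K I J : finType) (g : K -> I -> J -> R).
Hypothesis g_bound : forall k i j, -1 <= g k i j <= 1.
Implicit Types (u v : info R K) (s : strategy R I) (t : strategy R J).

Definition pay s t (x : outcome K) : R :=
  \sum_i \sum_j s x.1.2 i * t x.2 j * g x.1.1 i j.

Lemma expected_payoffE u s t : expected_payoff u g s t = Ex u (pay s t).
Proof. by apply: eq_tsum => -[[k c] d]. Qed.

Lemma norm_pay_le1 s t x : `|pay s t x| <= 1.
Proof.
rewrite (le_trans (ler_norm_sum _ _ _))// -(sum_pmf (s x.1.2)).
apply: ler_sum => i _; rewrite (le_trans (ler_norm_sum _ _ _))//.
rewrite -[leRHS]mulr1 -(sum_pmf (t x.2)) mulr_sumr.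
apply: ler_sum => j _; rewrite !normrM (ger0_norm (pmf_ge0 _ i)).
  rewrite (ger0_norm (pmf_ge0 _ j)) ler_piMr//.
  by rewrite mulr_ge0 ?pmf_ge0.
by rewrite ler_norml.
Qed.

Lemma bnd_pay s t : bnd (pay s t).
Proof. exact: bnd_le (norm_pay_le1 s t). Qed.

Lemma expected_payoff_norm u s t : `|expected_payoff u g s t| <= 1.
Proof. by rewrite expected_payoffE; exact/ler_norm_Ex/norm_pay_le1. Qed.

End Payoffs.

(** ** Garbling a signal and strategies *)
Section StrategyAfterGarbling.
Variables (R : realType) (A : finType) (s : strategy R A) (q : garbling R).

Let after_fun c a := Ex (q c) (fun c' => s c' a).

Let after_ge0 c a : 0 <= after_fun c a.
Proof. by apply: Ex_ge0 => c'; exact: pmf_ge0. Qed.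

Let sum_after c : \sum_a after_fun c a = 1.
Proof.
rewrite -Ex_sum; last by move=> a; exact: (bnd_pmf s a id).
by rewrite -[RHS](Ex_cst (q c) 1); apply: eq_Ex => c'; exact: sum_pmf.
Qed.

Definition after : strategy R A := fun c => fprob (after_ge0 c) (sum_after c).

End StrategyAfterGarbling.

Section PayoffAfterGarbling.
Variables (R : realType) (K I J : finType) (g : K -> I -> J -> R).
Hypothesis g_bound : forall k i j, -1 <= g k i j <= 1.
Implicit Types (u v : info R K) (s : strategy R I) (t : strategy R J).

(** Player 1 can simulate a garbling of his own signal. *)
Lemma payoff_garbled1 q u s t :
  expected_payoff (garbled1 q u) g s t = expected_payoff u g (after s q) t.
Proof.
rewrite !expected_payoffE Ex_garbled1; last exact: bnd_pay.
apply: eq_Ex => x; rewrite /pay /= Ex_sum; last first.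
  move=> i; apply: bnd_sum => j.
  apply: bndM; last exact: bnd_cst.
  by apply: bndM; [exact: (bnd_pmf s i id)|exact: bnd_cst].
apply: eq_bigr => i _; rewrite Ex_sum; last first.
  move=> j; apply: bndM; last exact: bnd_cst.
  by apply: bndM; [exact: (bnd_pmf s i id)|exact: bnd_cst].
apply: eq_bigr => j _; rewrite -mulrA [RHS]mulrC -ExZ; last first.
  exact: (bnd_pmf s i id).
by apply: eq_Ex => c; rewrite -mulrA mulrC.
Qed.

Lemma payoff_garbled2 u q s t :
  expected_payoff (garbled2 u q) g s t = expected_payoff u g s (after t q).
Proof.
rewrite !expected_payoffE Ex_garbled2; last exact: bnd_pay.
apply: eq_Ex => x; rewrite /pay /= Ex_sum; last first.
  move=> i; apply: bnd_sum => j.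
  apply: bndM; last exact: bnd_cst.
  by apply: bndM; [exact: bnd_cst|exact: (bnd_pmf t j id)].
apply: eq_bigr => i _; rewrite Ex_sum; last first.
  move=> j; apply: bndM; last exact: bnd_cst.
  by apply: bndM; [exact: bnd_cst|exact: (bnd_pmf t j id)].
apply: eq_bigr => j _; rewrite mulrAC -ExZ; last first.
  exact: (bnd_pmf t j id).
by apply: eq_Ex => c; rewrite mulrAC.
Qed.

End PayoffAfterGarbling.

(** * Existence of the value *)

(** The outcomes outside of the part of the structure that [n + 1] labels can
    describe. *)
Definition far (K : choiceType) (n : nat) (x : K * nat * nat) : bool :=
  (n < x.1.2)%N || (n < x.2)%N.

Lemma far_tail (R : realType) (K : finType) (p : info R K) (e : R) : 0 < e ->
  exists n0, forall n, (n0 <= n)%N -> Ex p (fun x => (far n x)%:R) <= e.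
Proof.
move=> e0; have [X finX tailX] := asum_tail (pmf_ge0 p) (asum_pmf p) e0.
exists (\max_(x <- finmap.enum_fset (fset_set X)) (x.1.2 + x.2)%N) => n le_n.
have := tailX [set x | ~~ far n x].
rewrite (_ : tsum _ = Ex p (fun x => (far n x)%:R)); last first.
  apply: eq_tsum => x; have [far_x|near_x] := boolP (far n x).
    by rewrite memNset//=; apply/negP; rewrite negbK.
  by rewrite mem_set.
apply=> x Xx; rewrite /= /far negb_or -!leqNgt.
have : (x.1.2 + x.2 <= n)%N.
  apply: leq_trans le_n; apply: (@leq_bigmax_seq _ _ _
    (fun x : outcome K => (x.1.2 + x.2)%N)) => //.
  by rewrite in_fset_set// mem_set.
by move=> h; rewrite !(leq_trans _ h) ?leq_addl ?leq_addr.
Qed.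

Section MixtureOfPureStrategies.
Variables (R : realType) (K I J : finType) (g : K -> I -> J -> R).
Hypothesis g_bound : forall k i j, -1 <= g k i j <= 1.
Variable u : info R K.

(** Used for two kinds of mixtures of pure strategies: with the product weights
    of a given strategy, and with the weights given by the minimax theorem. *)
Lemma payoff_mixture (S : finType) (l : S -> R) (s : strategy R I)
    (t : strategy R J) (tS : S -> strategy R J) :
  (forall d j, t d j = \sum_a l a * tS a d j) ->
  expected_payoff u g s t = \sum_a l a * expected_payoff u g s (tS a).
Proof.
move=> tE; rewrite expected_payoffE.
rewrite [RHS](eq_bigr (fun a => Ex u (fun x => l a * pay g s (tS a) x)));
  last by move=> a _; rewrite expected_payoffE ExZ//; exact: bnd_pay.
rewrite -Ex_sum; last by move=> a; exact/bndZ/bnd_pay.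
apply: eq_Ex => x; rewrite /pay.
under [RHS]eq_bigr do rewrite mulr_sumr.
rewrite [RHS]exchange_big/=; apply: eq_bigr => i _.
under [RHS]eq_bigr do rewrite mulr_sumr.
rewrite [RHS]exchange_big/=; apply: eq_bigr => j _.
rewrite tE mulr_sumr mulr_suml; apply: eq_bigr => a _; lra.
Qed.

Lemma payoff_mix (r : R) (r01 : 0 <= r <= 1) (s s' : strategy R I)
    (t : strategy R J) :
  expected_payoff u g (fun c => mix (s c) (s' c) r01) t =
  (1 - r) * expected_payoff u g s t + r * expected_payoff u g s' t.
Proof.
rewrite !expected_payoffE -!ExZ; do ?[exact: bnd_pay].
rewrite -ExD; do ?[exact/bndZ/bnd_pay].
apply: eq_Ex => x; rewrite /pay /= !mulr_sumr -big_split/=.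
apply: eq_bigr => i _; rewrite !mulr_sumr -big_split/=.
by apply: eq_bigr => j _; lra.
Qed.

Variable n : nat.

(** [inord] sends every signal above [n] to [0]. *)
Definition pure (tau : {ffun 'I_n.+1 -> J}) : strategy R J :=
  fun d => point R (tau (inord d)).

(** A behavior strategy with finitely many signals is a mixture of pure ones:
    draw the actions after the different signals independently. *)
Lemma product_weights (t : 'I_n.+1 -> prob R J) :
  exists l : {ffun 'I_n.+1 -> J} -> R,
    [/\ forall tau, 0 <= l tau, \sum_tau l tau = 1 &
        forall d j, t d j = \sum_tau l tau * (j == tau d)%:R].
Proof.
exists (fun tau : {ffun 'I_n.+1 -> J} => \prod_d t d (tau d)); split.
- by move=> tau; apply: prodr_ge0 => d _; exact: pmf_ge0.
- rewrite -(bigA_distr_bigA (fun d j => t d j)) big1// => d _; exact: sum_pmf.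
move=> d j.
rewrite (eq_bigr (fun tau : {ffun 'I_n.+1 -> J} =>
  \prod_d' (t d' (tau d') * ((d' == d) ==> (j == tau d'))%:R))); last first.
  move=> tau _; rewrite big_split/=; congr (_ * _).
  rewrite (bigD1 d)//= eqxx big1 ?mulr1// => d' /negPf d'd.
  by rewrite d'd.
rewrite -(bigA_distr_bigA (fun d' j' =>
  t d' j' * ((d' == d) ==> (j == j'))%:R)) (bigD1 d)//= [X in _ * X]big1.
  rewrite mulr1 (bigD1 j)//= !eqxx mulr1 big1 ?addr0// => j' /negPf j'j.
  by rewrite eq_sym j'j mulr0.
move=> d' /negPf ->.
by rewrite -[RHS](sum_pmf (t d')); apply: eq_bigr => j' _; rewrite /= mulr1.
Qed.

(** Payoffs lie in [[-1, 1]], so changing the actions on an event costs at most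
    twice its probability. *)
Lemma truncation_cost (s : strategy R I) (t : strategy R J) :
  expected_payoff u g s (fun d => t (inord d : 'I_n.+1)) <=
  expected_payoff u g s t + 2 * Ex u (fun x => (far n x)%:R).
Proof.
have bfar := bnd_indicator R (@far K n : outcome K -> bool).
rewrite !expected_payoffE -ExZ//.
rewrite -ExD; [|exact: bnd_pay|exact: bndZ].
apply: le_Ex; [exact: bnd_pay|by apply: bndD; [exact: bnd_pay|exact: bndZ]|].
move=> x; have [far_x|near_x] := boolP (far n x).
  have := norm_pay_le1 g_bound s t x.
  have := norm_pay_le1 g_bound s (fun d => t (inord d : 'I_n.+1)) x.
  by rewrite !ler_norml => /andP[_ ?] /andP[? _]; rewrite /=; lra.
rewrite mulr0 addr0 /pay; move: near_x; rewrite /far negb_or -!leqNgt.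
by move=> /andP[_ x2n]; rewrite inordK// ltnS.
Qed.

(** The finite family of functions to which the minimax theorem is applied. An
    average of pure payoffs being below the bound, one of them is. *)
Lemma pure_response (s : strategy R I) (t : strategy R J) :
  exists tau, expected_payoff u g s (pure tau) <=
    expected_payoff u g s t + 2 * Ex u (fun x => (far n x)%:R).
Proof.
set M := _ + _.
have [l [l0 l1 lE]] := product_weights (fun d => t d).
have mixE : expected_payoff u g s (fun d => t (inord d : 'I_n.+1)) =
    \sum_tau l tau * expected_payoff u g s (pure tau).
  apply: payoff_mixture => d j; rewrite lE; apply: eq_bigr => tau _.
  by rewrite /pure /= mulr1.
apply: contrapT => /forallNP no.
have : M < M.
  apply: lt_le_trans (truncation_cost s t); rewrite mixE -[ltLHS]mul1r -l1.
  rewrite mulr_suml.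
  have [tau l_tau] : exists tau, 0 < l tau.
    apply: contrapT => /forallNP nol; have : 0 < 1 :> R by [].
    rewrite -l1 big1 ?ltxx// => tau _; apply/eqP.
    by rewrite eq_le l0 andbT leNgt; apply/negP/nol.
  rewrite (bigD1 tau)//= [ltRHS](bigD1 tau)//= ltr_leD//.
    by rewrite ltr_pM2l// ltNge; apply/negP/no.
  apply: ler_sum => tau' _; rewrite ler_wpM2l//.
  by rewrite ltW// ltNge; apply/negP/no.
by rewrite ltxx.
Qed.

End MixtureOfPureStrategies.

Section Value.
Variables (R : realType) (K I J : finType) (g : K -> I -> J -> R).
Hypothesis gG : in_G g.
Variable u : info R K.

Let g_bound k i j : -1 <= g k i j <= 1. Proof. by case: gG. Qed.

Let P (s : strategy R I) (t : strategy R J) := expected_payoff u g s t.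

Let P1 s t : -1 <= P s t <= 1.
Proof. by rewrite -ler_norml; exact: expected_payoff_norm. Qed.

(* Wrapped in a sigma type so that a strategy can be chosen once and for all
   from the mere nonemptiness of the action set. *)
Let s0 : {s : strategy R I | True}.
Proof.
by apply: cid; have [/card_gt0P[i _] _ _] := gG; exists (fun=> point R i).
Qed.

Let t0 : {t : strategy R J | True}.
Proof.
by apply: cid; have [_ /card_gt0P[j _] _] := gG; exists (fun=> point R j).
Qed.

Let has_inf_row s : has_inf (range (P s)).
Proof.
split; first by exists (P s (sval t0)), (sval t0).
by exists (-1) => _ [t _ <-]; have /andP[] := P1 s t.
Qed.

Let has_sup_col t : has_sup (range (P^~ t)).
Proof.
split; first by exists (P (sval s0) t), (sval s0).
by exists 1 => _ [s _ <-]; have /andP[] := P1 s t.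
Qed.

Let maxmin_u := maxmin u g.

Let has_sup_inf : has_sup (range (fun s => inf (range (P s)))).
Proof.
split; first by exists (inf (range (P (sval s0)))), (sval s0).
exists 1 => _ [s _ <-]; apply: le_trans (_ : P s (sval t0) <= 1).
  by apply: ge_inf; [case: (has_inf_row s)|exists (sval t0)].
by have /andP[] := P1 s (sval t0).
Qed.

Let maximizer_guarantee e : 0 < e ->
  exists s, forall t, maxmin_u - e <= P s t.
Proof.
move=> e0; have [_ [s _ <-] lt_s] := sup_adherent e0 has_sup_inf.
exists s => t; rewrite (le_trans (ltW lt_s))//.
by apply: ge_inf; [case: (has_inf_row s)|exists t].
Qed.

(* Against each [s] some pure strategy keeps the payoff below
   [maxmin + e]; the minimax theorem turns these into one mixture good against
   every [s], and its marginals into a behavior strategy. *)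
Let minimizer_guarantee e : 0 < e ->
  exists t, forall s, P s t <= maxmin_u + e.
Proof.
move=> e0; have e4 : 0 < e / 4 by rewrite divr_gt0.
have [n /(_ n (leqnn n)) far_n] := far_tail u e4.
have row s : exists tau : {ffun 'I_n.+1 -> J}, P s (pure R tau) <= maxmin_u + e.
  have [_ [t _ <-] lt_t] := inf_adherent e4 (has_inf_row s).
  have [tau] := pure_response g_bound u n s t; exists tau.
  have : P s (pure R tau) <= P s t + 2 * Ex u (fun x => (far n x)%:R) by [].
  have : inf (range (P s)) <= maxmin_u.
    by apply: ub_le_sup; [case: has_sup_inf|exists s].
  move: far_n lt_t.
  by move: (Ex u _) (P s t) (P s _) (inf _) (maxmin_u) => *; lra.
have [|x y r r01|l [l0 l1] lP] :=
  @minimax R _ _ (fun s tau => P s (pure R tau)) (sval s0) 1 (maxmin_u + e)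
    _ _ row.
- by move=> s tau; rewrite ler_norml.
- by exists (fun c => mix (x c) (y c) r01) => tau; exact: payoff_mix.
pose t_fun (d : nat) j := \sum_tau l tau * (j == tau (inord d : 'I_n.+1))%:R.
have t_ge0 d j : 0 <= t_fun d j by apply: sumr_ge0 => tau _; rewrite mulr_ge0.
have t_sum1 d : \sum_j t_fun d j = 1.
  rewrite exchange_big/= -[RHS]l1; apply: eq_bigr => tau _.
  rewrite (bigD1 (tau (inord d)))//= eqxx mulr1 big1 ?addr0// => j /negPf ->.
  by rewrite mulr0.
exists (fun d => fprob (t_ge0 d) (t_sum1 d)) => s.
rewrite /P (payoff_mixture g_bound u (l := l) s (tS := @pure R J n)) ?lP//.
move=> d j.
by apply: eq_bigr => tau _ /=; rewrite mulr1.
Qed.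

Let maxminE : maxmin_u = minmax u g.
Proof.
have has_inf_sup : has_inf (range (fun t => sup (range (P^~ t)))).
  split; first by exists (sup (range (P^~ (sval t0)))), (sval t0).
  exists (-1) => _ [t _ <-]; apply: (@le_trans _ _ (P (sval s0) t)).
    by have /andP[] := P1 (sval s0) t.
  by apply: ub_le_sup; [case: (has_sup_col t)|exists (sval s0)].
apply/eqP; rewrite eq_le; apply/andP; split; apply/ler_addgt0Pr => e e0.
  have [s sP] := maximizer_guarantee e0.
  rewrite -lerBlDr; apply: lb_le_inf; first by case: has_inf_sup.
  move=> _ [t _ <-]; rewrite (le_trans (sP t))//.
  by apply: ub_le_sup; [case: (has_sup_col t)|exists s].
have [t tP] := minimizer_guarantee e0.
apply: (@le_trans _ _ (sup (range (P^~ t)))).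
  by apply: ge_inf; [case: has_inf_sup|exists t].
by apply: ge_sup; [case: (has_sup_col t)|move=> _ [s _ <-]].
Qed.

Let game_valueE : game_value u g = maxmin_u.
Proof.
have /(xgetPex 2)[valE _] : exists w, is_value u g w by exists maxmin_u.
exact: valE.
Qed.

Lemma value_maximizer e : 0 < e ->
  exists s, forall t, game_value u g - e <= expected_payoff u g s t.
Proof. by rewrite game_valueE; exact: maximizer_guarantee. Qed.

Lemma value_minimizer e : 0 < e ->
  exists t, forall s, expected_payoff u g s t <= game_value u g + e.
Proof. by rewrite game_valueE; exact: minimizer_guarantee. Qed.

Lemma le_value (a : R) s :
  (forall t, a <= expected_payoff u g s t) -> a <= game_value u g.
Proof.
move=> as_; apply/ler_addgt0Pr => e /value_minimizer[t tP].
exact: le_trans (as_ t) (tP s).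
Qed.

Lemma ge_value (a : R) t :
  (forall s, expected_payoff u g s t <= a) -> game_value u g <= a.
Proof.
move=> sa; apply/ler_addgt0Pr => e /value_maximizer[s sP].
by rewrite -lerBlDr; exact: le_trans (sP t) (sa s).
Qed.

Lemma norm_value_le1 : `|game_value u g| <= 1.
Proof.
rewrite ler_norml; apply/andP; split.
  by apply: (@le_value _ (sval s0)) => t; have /andP[] := P1 (sval s0) t.
by apply: (@ge_value _ (sval t0)) => s; have /andP[] := P1 s (sval t0).
Qed.

End Value.

(** Weak duality. Take [s] near-optimal in [v] and [t] near-optimal in [u]; play
    [t] after [q2] against [s] in [v], and [s] after [q1] against [t] in [u].
    Both payoffs are expectations of the same function, bounded by [1], under
    [v.q2] and [q1.u]. *)
Lemma value_gap_le_tv (R : realType) (K I J : finType) (g : K -> I -> J -> R)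
    (u v : info R K) (q1 q2 : garbling R) : in_G g ->
  game_value v g - game_value u g <= tv_dist (garble1 q1 u) (garble2 v q2).
Proof.
move=> gG; have g_bound k i j : -1 <= g k i j <= 1 by case: gG.
rewrite garble1E garble2E tv_distC.
apply/ler_addgt0Pr => e e0; have e2 : 0 < e / 2 by rewrite divr_gt0.
have [s sP] := value_maximizer gG v e2.
have [t tP] := value_minimizer gG u e2.
have := sP (after t q2); rewrite -payoff_garbled2//.
have := tP (after s q1); rewrite -payoff_garbled1// !expected_payoffE.
have := Ex_diff_le_tv (garbled2 v q2) (garbled1 q1 u) (norm_pay_le1 g_bound s t).
by move: (Ex _ _) (Ex _ _) (tv_dist _ _) => *; lra.
Qed.

(** * Games of announcements *)
Section LabelledActions.
Variables (R : realType) (n : nat).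
Local Notation A := 'I_n.+1.
Implicit Types p : prob R A.

Let push_fun p (c : nat) := \sum_(a : A) (c == a)%:R * p a.

Let push_term p (a : A) : asum (fun c : nat => (c == a)%:R * p a) /\
  tsum (fun c : nat => (c == a)%:R * p a) = p a.
Proof.
by apply: (@tsum_point R _ (a : nat) (fun=> p a)) => c; exact: pmf_ge0.
Qed.

Let push_ge0 p c : 0 <= push_fun p c.
Proof. by apply: sumr_ge0 => a _; rewrite mulr_ge0 ?pmf_ge0. Qed.

Let asum_push p : asum (push_fun p).
Proof. by apply: asum_sum => a; case: (push_term p a). Qed.

Let tsum_push p : tsum (push_fun p) = 1.
Proof.
rewrite tsum_sum; last by move=> a; case: (push_term p a).
by rewrite -[RHS](sum_pmf p); apply: eq_bigr => a _; case: (push_term p a).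
Qed.

(** A mixed announcement, seen as the law of a new signal: this is how a
    strategy becomes a garbling. *)
Definition label p : prob R nat :=
  mkprob (push_ge0 p) (asum_push p) (tsum_push p).

Lemma label_support p c : (n < c)%N -> label p c = 0.
Proof.
move=> nc; apply: big1 => a _; case: eqP => [ca|_]; last by rewrite mul0r.
by move: nc; rewrite ca ltnNge -ltnS ltn_ord.
Qed.

Lemma Ex_label p h : bnd h -> Ex (label p) h = \sum_(a : A) p a * h a.
Proof.
move=> bh; rewrite /Ex.
have -> : (fun c => label p c * h c) =
    (fun c => \sum_(a : A) p a * ((point R (a : nat)) c * h c)).
  apply/funext => c; rewrite mulr_suml; apply: eq_bigr => a _ /=.
  by rewrite mulr1; ring.
rewrite tsum_sum; last by move=> a; exact/asumZ/asum_Ex.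
apply: eq_bigr => a _; rewrite tsumZ; last exact: asum_Ex.
by rewrite -/(Ex _ _) Ex_point.
Qed.

End LabelledActions.

Section TruthfulPlay.
Variables (R : realType) (K : finType) (n : nat).
Local Notation A := 'I_n.+1.
Variable g : K -> A -> A -> R.
Hypothesis gG : in_G g.
Implicit Types u v : info R K.

Let g_bound k i j : -1 <= g k i j <= 1. Proof. by case: gG. Qed.

(** The payoff when both players announce the signals of [x], any signal above
    [n] being announced as [0]. *)
Definition on_signals (f : K -> A -> A -> R) (x : outcome K) : R :=
  f x.1.1 (inord x.1.2) (inord x.2).

Let norm_on_signals x : `|on_signals g x| <= 1.
Proof. by rewrite ler_norml; exact: g_bound. Qed.

Definition truthful : strategy R A := fun c => point R (inord c).

(* The opponent of a truthful player chooses a garbling of his own signal. *)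
Let payoff_truthful1 v (t : strategy R A) : expected_payoff v g truthful t =
  Ex (garbled2 v (fun d => label (t d))) (on_signals g).
Proof.
rewrite expected_payoffE Ex_garbled2; last exact: bnd_le norm_on_signals.
apply: eq_Ex => x; rewrite Ex_label; last first.
  by exists 1 => d; exact: norm_on_signals.
rewrite /pay (bigD1 (inord x.1.2))//= [X in _ + X]big1 ?addr0.
  by apply: eq_bigr => j _; rewrite eqxx !mul1r /on_signals/= inord_val.
by move=> i /negPf ix; apply: big1 => j _; rewrite ix !mul0r.
Qed.

Let payoff_truthful2 u (s : strategy R A) : expected_payoff u g s truthful =
  Ex (garbled1 (fun c => label (s c)) u) (on_signals g).
Proof.
rewrite expected_payoffE Ex_garbled1; last exact: bnd_le norm_on_signals.
apply: eq_Ex => x; rewrite Ex_label; last first.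
  by exists 1 => d; exact: norm_on_signals.
apply: eq_bigr => i _; rewrite (bigD1 (inord x.2))//= [X in _ + X]big1 ?addr0.
  by rewrite eqxx !mulr1 /on_signals/= inord_val.
by move=> j /negPf jx; rewrite jx mul0r mulr0 mul0r.
Qed.

(** Against a truthful player the opponent can only garble his own signal, so a
    bound on the pairing valid for all garblings is a guarantee for truthful
    play in [v] by player 1 and in [u] by player 2. *)
Lemma le_value_gap u v (a : R) :
  (forall q1 q2, in_garbling n.+1 q1 -> in_garbling n.+1 q2 ->
    a <= Ex (garbled2 v q2) (on_signals g) -
         Ex (garbled1 q1 u) (on_signals g)) ->
  a <= game_value v g - game_value u g.
Proof.
move=> aP; rewrite lerBrDr; apply: (@le_value _ _ _ _ _ gG _ _ truthful) => t.
rewrite -lerBrDl; apply: (@ge_value _ _ _ _ _ gG _ _ truthful) => s.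
rewrite payoff_truthful1 payoff_truthful2 lerBrDr addrC -lerBrDr.
by apply: aP => d c; exact: label_support.
Qed.

End TruthfulPlay.

Section MixedGarblings.
Variables (R : realType) (K : finType) (u : info R K) (q q' : garbling R).
Variables (s : R) (s01 : 0 <= s <= 1) (h : outcome K -> R).
Hypothesis bh : bnd h.

(** The convexity on the side of the garblings in the minimax theorem. *)
Definition mix_garbling : garbling R := fun c => mix (q c) (q' c) s01.

Let bEx (S : choiceType) (p : S -> prob R nat) (f : S -> nat -> outcome K) :
  bnd (fun x => Ex (p x) (fun c => h (f x c))).
Proof.
by have [B hB] := bh; exists B => x; apply: ler_norm_Ex => c; exact: hB.
Qed.

Let bfib (f : nat -> outcome K) : bnd (fun c => h (f c)).
Proof. by have [B hB] := bh; exists B. Qed.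

Lemma Ex_mix_garbling1 : Ex (garbled1 mix_garbling u) h =
  (1 - s) * Ex (garbled1 q u) h + s * Ex (garbled1 q' u) h.
Proof.
rewrite !Ex_garbled1// -!ExZ; do ?[exact: bEx].
rewrite -ExD; do ?[exact/bndZ/bEx].
by apply: eq_Ex => x; rewrite Ex_mix.
Qed.

Lemma Ex_mix_garbling2 : Ex (garbled2 u mix_garbling) h =
  (1 - s) * Ex (garbled2 u q) h + s * Ex (garbled2 u q') h.
Proof.
rewrite !Ex_garbled2// -!ExZ; do ?[exact: bEx].
rewrite -ExD; do ?[exact/bndZ/bEx].
by apply: eq_Ex => x; rewrite Ex_mix.
Qed.

End MixedGarblings.

(** ** The dual game *)

Lemma sign_gain (R : realType) (a b : R) (s := if a <= b then 1 else -1 : R) :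
  `|b - a| <= b * s - a * s.
Proof. by rewrite /s; case: (lerP a b) => ?; lra. Qed.

Lemma far_mass_loss (R : realType) (a b s : R) : 0 <= a -> 0 <= b ->
  `|s| <= 1 -> `|b - a| - 2 * (a + b) <= b * s - a * s.
Proof.
rewrite ler_norml => a0 b0 /andP[s_ge s_le].
by case: (ger0P (b - a)) => _; nra.
Qed.

Section DualGame.
Variables (R : realType) (K : finType) (n : nat).
Local Notation A := 'I_n.+1.
Variables (u v : info R K) (delta m : R).
Implicit Types q : garbling R.

(** The new signal of player 1 is at most [n] and that of player 2 is not
    modified. *)
Lemma far_garbled1 q : in_garbling n.+1 q ->
  Ex (garbled1 q u) (fun x => (far n x)%:R) <= Ex u (fun x => (far n x)%:R).
Proof.
move=> qn.
rewrite Ex_garbled1; last exact: (bnd_indicator R (@far K n)).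
apply: le_Ex.
- by exists 1 => x; apply: ler_norm_Ex => c; case: far;
    rewrite ?normr1 ?normr0.
- exact: (bnd_indicator R (@far K n)).
move=> x; rewrite -[leRHS](Ex_cst (q x.1.2)).
apply: le_tsum;
  [exact/asum_Ex/(bnd_indicator R (fun c => far n (x.1.1, c, x.2)))
  |exact/asum_Ex/bnd_cst|move=> c].
rewrite /far/=; have [nc|cn] := ltnP n c; first by rewrite qn// !mul0r.
by rewrite ler_wpM2l ?pmf_ge0//; case: (n < x.2)%N; rewrite ?orbT//= ler0n.
Qed.

Lemma far_garbled2 q : in_garbling n.+1 q ->
  Ex (garbled2 v q) (fun x => (far n x)%:R) <= Ex v (fun x => (far n x)%:R).
Proof.
move=> qn.
rewrite Ex_garbled2; last exact: (bnd_indicator R (@far K n)).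
apply: le_Ex.
- by exists 1 => x; apply: ler_norm_Ex => c; case: far;
    rewrite ?normr1 ?normr0.
- exact: (bnd_indicator R (@far K n)).
move=> x; rewrite -[leRHS](Ex_cst (q x.2)).
apply: le_tsum; [exact/asum_Ex/(bnd_indicator R (fun c => far n (x.1, c)))
  |exact/asum_Ex/bnd_cst|move=> c].
rewrite /far/=; have [nc|cn] := ltnP n c; first by rewrite qn// !mul0r.
by rewrite ler_wpM2l ?pmf_ge0//; case: (n < x.1.2)%N; rewrite ?orbT//= ler0n.
Qed.

Hypothesis u_delta : Ex u (fun x => (far n x)%:R) <= delta.
Hypothesis v_delta : Ex v (fun x => (far n x)%:R) <= delta.
Hypothesis m_le_tv : forall q1 q2, in_garbling n.+1 q1 ->
  in_garbling n.+1 q2 -> m <= tv_dist (garble1 q1 u) (garble2 v q2).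

Local Notation signs := {ffun K * A * A -> bool}.
(* The vertices of the cube of payoff functions on [K * A * A]: one vertex
   attains the norm, and finitely many functions are enough for the minimax
   theorem. *)
Let sgn (b : bool) : R := if b then 1 else -1.
Let sgn_on (gam : signs) : outcome K -> R :=
  on_signals (fun k i j => sgn (gam (k, i, j))).

Let norm_sgn_on gam x : `|sgn_on gam x| <= 1.
Proof.
by rewrite /sgn_on /on_signals /sgn; case: ifP; rewrite ?normrN normr1.
Qed.

Let bnd_sgn gam : bnd (sgn_on gam). Proof. exact: bnd_le (norm_sgn_on gam). Qed.

(** The sign of [v.q2 - q1.u] attains the norm on the outcomes with signals at
    most [n]. The others contribute at most twice their mass under both
    structures. *)
Lemma sign_response q1 q2 : in_garbling n.+1 q1 -> in_garbling n.+1 q2 ->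
  exists gam, Ex (garbled1 q1 u) (sgn_on gam) - Ex (garbled2 v q2) (sgn_on gam)
    <= 4 * delta - m.
Proof.
move=> q1n q2n; have := m_le_tv q1n q2n; rewrite garble1E garble2E tv_distC.
have := le_trans (far_garbled1 q1n) u_delta.
have := le_trans (far_garbled2 q2n) v_delta.
set a := garbled1 q1 u; set b := garbled2 v q2.
pose gam : signs := [ffun y : K * A * A =>
  a (y.1.1, y.1.2 : nat, y.2 : nat) <= b (y.1.1, y.1.2 : nat, y.2 : nat)].
move=> far_b far_a tv_ab; exists gam.
have bfar := bnd_indicator R (@far K n : outcome K -> bool).
suff : tv_dist b a - 2 * (Ex a (fun x => (far n x)%:R) +
    Ex b (fun x => (far n x)%:R)) <= Ex b (sgn_on gam) - Ex a (sgn_on gam).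
  move: far_a far_b tv_ab.
  by move: (tv_dist b a) (Ex a _) (Ex b _) (Ex a _) (Ex b _) => *; lra.
have sB : asum (fun x => `|b x - a x|).
  by apply/asum_norm/asumB; exact: asum_pmf.
have sfar : asum (fun x => 2 * (a x * (far n x)%:R + b x * (far n x)%:R)).
  by apply/asumZ/asumD; exact: asum_Ex.
rewrite /tv_dist /Ex -tsumD; do ?[exact: asum_Ex].
rewrite -tsumZ; last by apply: asumD; exact: asum_Ex.
rewrite -!tsumB//; do ?[exact: asum_Ex].
apply: le_tsum; [exact: asumB|by apply: asumB; exact: asum_Ex|move=> x].
have a0 := pmf_ge0 a x; have b0 := pmf_ge0 b x.
have [far_x|near_x] := boolP (far n x).
  by rewrite /= !mulr1; apply: far_mass_loss => //; exact: norm_sgn_on.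
rewrite /= !mulr0 addr0 mulr0 subr0.
move: near_x; rewrite /far negb_or -!leqNgt => /andP[cn dn].
have -> : sgn_on gam x = sgn (a x <= b x).
  rewrite /sgn_on /on_signals ffunE /= !inordK ?ltnS//.
  by case: (x) => [[k c] d].
exact: sign_gain.
Qed.

Let garblings_n :=
  {qq : garbling R * garbling R |
    in_garbling n.+1 qq.1 /\ in_garbling n.+1 qq.2}.

(** The minimax theorem applied to the convex set of pairs of garblings with
    [n + 1] labels; the mixture of sign functions is the payoff function. *)
Lemma dual_game : exists g : K -> A -> A -> R, in_G g /\
  forall q1 q2, in_garbling n.+1 q1 -> in_garbling n.+1 q2 ->
    m - 4 * delta <= Ex (garbled2 v q2) (on_signals g) -
                     Ex (garbled1 q1 u) (on_signals g).
Proof.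
have zero_n : in_garbling n.+1 (fun=> point R 0%N).
  by move=> c [|c']//= _; rewrite mul0r.
pose f (qq : garblings_n) gam := Ex (garbled1 (sval qq).1 u) (sgn_on gam) -
  Ex (garbled2 v (sval qq).2) (sgn_on gam).
have f2 qq gam : `|f qq gam| <= 2.
  rewrite (le_trans (ler_normB _ _))// -[leRHS]/(1 + 1) lerD//;
    exact: ler_norm_Ex (norm_sgn_on gam).
have mix_n s (s01 : 0 <= s <= 1) q q' : in_garbling n.+1 q ->
    in_garbling n.+1 q' -> in_garbling n.+1 (mix_garbling q q' s01).
  by move=> qn q'n c c' nc /=; rewrite qn// q'n// !mulr0 addr0.
have f_convex x y s : 0 <= s <= 1 ->
    exists z, forall gam, f z gam = (1 - s) * f x gam + s * f y gam.
  move=> s01; case: x => -[q1 q2] [/= q1n q2n].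
  case: y => -[r1 r2] [/= r1n r2n].
  exists (exist _ (mix_garbling q1 r1 s01, mix_garbling q2 r2 s01)
    (conj (mix_n _ _ _ _ q1n r1n) (mix_n _ _ _ _ q2n r2n))) => gam.
  rewrite /f /= Ex_mix_garbling1// Ex_mix_garbling2//.
  by do 4!(move: (Ex _ _) => ?); ring.
have f_le (qq : garblings_n) : exists gam, f qq gam <= 4 * delta - m.
  by have [q1n q2n] := svalP qq; exact: sign_response.
pose x0 : garblings_n := exist _ (_, _) (conj zero_n zero_n).
have [l [l0 l1] lP] := minimax x0 f2 f_convex f_le.
pose g k i j := \sum_gam l gam * sgn (gam (k, i, j)).
exists g; split.
  split; rewrite ?card_ord// => k i j.
  rewrite -ler_norml (le_trans (ler_norm_sum _ _ _))// -[leRHS]l1.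
  apply: ler_sum => gam _; rewrite normrM ger0_norm// ler_piMr//.
  by rewrite /sgn; case: ifP; rewrite ?normrN normr1.
have gE : on_signals g = fun x => \sum_gam l gam * sgn_on gam x by [].
have linear p : Ex p (on_signals g) = \sum_gam l gam * Ex p (sgn_on gam).
  rewrite gE Ex_sum; last by move=> gam; exact: bndZ.
  by apply: eq_bigr => gam _; rewrite ExZ.
move=> q1 q2 q1n q2n; have := lP (exist _ (q1, q2) (conj q1n q2n)).
rewrite !linear /f /=; under eq_bigr do rewrite mulrBr.
by rewrite sumrB -lerN2 !opprB.
Qed.

End DualGame.

(** * Attainment of the minimum *)

(** The missing mass is put on the signal [0]. *)
Lemma complete_subprobability (R : realType) (r : nat -> R) :
  (forall c, 0 <= r c) -> asum r -> tsum r <= 1 ->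
  exists p : prob R nat,
    (forall c, r c <= p c) /\ forall c, c != 0%N -> p c = r c.
Proof.
move=> r0 sr r1; have [s0 t0] := @tsum_point R _ 0%N (fun=> 1 - tsum r)
  (fun=> etrans (subr_ge0 _ _) r1).
pose f c := r c + (c == 0%N)%:R * (1 - tsum r).
have f0 c : 0 <= f c by rewrite addr_ge0// mulr_ge0// subr_ge0.
have f1 : tsum f = 1 by rewrite tsumD// t0 addrC subrK.
exists (mkprob f0 (asumD sr s0) f1); split=> c /=.
  by rewrite lerDl mulr_ge0// subr_ge0.
by rewrite /f => /negPf ->; rewrite mul0r addr0.
Qed.

Lemma le_min2 (R : realType) (a b a' b' : R) : a <= a' -> b <= b' ->
  Num.min a b <= Num.min a' b'.
Proof. by move=> aa' bb'; rewrite le_min !ge_min aa' bb' orbT. Qed.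

Lemma cvg_min (R : realType) (I : Type) (F : set_system I) (f g : I -> R)
    (a b : R) : Filter F -> f i @[i --> F] --> a -> g i @[i --> F] --> b ->
  Num.min (f i) (g i) @[i --> F] --> Num.min a b.
Proof.
move=> FF fa gb; under eq_fun do rewrite minr_absE; rewrite minr_absE.
apply: cvgM; last exact: cvg_cst.
by apply: cvgB; [exact: cvgD|apply: cvg_norm; exact: cvgB].
Qed.

Section Fibre.
Variables (R : realType) (T : choiceType) (coord : T -> nat) (upd : T -> nat -> T).
Hypothesis coord_upd : forall x c, coord (upd x c) = c.

Lemma asum_fibre (u : prob R T) x : asum (fun c => u (upd x c)).
Proof.
apply/asum_ge0P; first by move=> c; exact: pmf_ge0.
have u0 (y : T) : (0 <= (u y)%:E)%E by rewrite lee_fin pmf_ge0.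
rewrite ge0_fin_numE; last by apply: esum_ge0 => c _; exact: u0.
have inj : set_inj [set: nat] (upd x).
  by move=> c d _ _ /(congr1 coord); rewrite !coord_upd.
rewrite -(@esum_image R _ _ setT (upd x) (fun y => (u y)%:E) inj).
apply: (@le_lt_trans _ _ 1%E); last exact: ltry.
rewrite -(pmf_sum1 u) esum_mkcond; apply: le_esum => y _.
by case: ifP.
Qed.

End Fibre.

Section Overlap.
Variables (R : realType) (K : finType).
Implicit Types p u v : info R K.

(** Unlike the total variation, the overlap is monotone in both structures. *)
Definition overlap (a b : outcome K -> R) :=
  tsum (fun x => Num.min (a x) (b x)).

Lemma asum_min (a b : outcome K -> R) : (forall x, 0 <= a x) ->
  (forall x, 0 <= b x) -> asum a -> asum (fun x => Num.min (a x) (b x)).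
Proof.
move=> a0 b0; apply: le_asum => x; rewrite ger0_norm ?ge_min ?lexx//.
by rewrite le_min a0 b0.
Qed.

Lemma tv_overlap p p' : tv_dist p p' = 2 - 2 * overlap p p'.
Proof.
have sp := asum_pmf p; have sp' := asum_pmf p'.
have sm := asum_min (pmf_ge0 p) (pmf_ge0 p') sp.
transitivity (tsum p + tsum p' - 2 * overlap p p'); last first.
  by rewrite !tsum_pmf.
rewrite /overlap -tsumZ// -tsumD// -tsumB; [|exact: asumD|exact: asumZ].
by apply: eq_tsum => x; rewrite minr_absE; lra.
Qed.

Lemma overlap_le1 p p' : overlap p p' <= 1.
Proof.
rewrite -(tsum_pmf p); apply: le_tsum; last by move=> x; rewrite ge_min lexx.
- exact/asum_min/asum_pmf/pmf_ge0/pmf_ge0.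
- exact: asum_pmf.
Qed.

Lemma finite_near n : finite_set [set x : outcome K | ~~ far n x].
Proof.
pose emb (y : K * 'I_n.+1 * 'I_n.+1) : outcome K :=
  (y.1.1, y.1.2 : nat, y.2 : nat).
apply: (@sub_finite_set _ _ (emb @` setT)); last first.
  by apply: finite_image; exact: finite_finset.
move=> [[k c] d] /=; rewrite /far negb_or -!leqNgt /= => /andP[cn dn].
by exists (k, inord c, inord d) => //; rewrite /emb /= !inordK ?ltnS.
Qed.

End Overlap.

(** [D] is the set of signals that the garblings may produce: all of them, or
    those below a bound. It contains [0], where missing mass is put. *)
Section Attainment.
Variables (R : realType) (K : finType) (u v : info R K).
Variable D : pred nat.
Hypothesis D0 : D 0%N.

Definition supported (q : garbling R) := forall c c', ~~ D c' -> q c c' = 0.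

Let ov q1 q2 := overlap (garbled1 q1 u) (garbled2 v q2).

Let near n (x : outcome K) : R := (x \in [set x : outcome K | ~~ far n x])%:R.

(** Where [n < x.2], the overlap is at most [q1.u], whose law of [x.2] is that
    of [u]; where [n < x.1.2], it is at most [v.q2], whose law of [x.1.2] is
    that of [v]. The bound does not depend on the garblings. *)
Lemma overlap_tight n q1 q2 : ov q1 q2 <=
  tsum (fun x => Num.min (garbled1 q1 u x) (garbled2 v q2 x) * near n x) +
  (Ex u (fun x => (far n x)%:R) + Ex v (fun x => (far n x)%:R)).
Proof.
set a := garbled1 q1 u; set b := garbled2 v q2.
have far_a : Ex a (fun x => (n < x.2)%:R) <= Ex u (fun x => (far n x)%:R).
  rewrite Ex_garbled1; last first.
    exact: (bnd_indicator R (fun x : outcome K => (n < x.2)%N)).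
  under eq_Ex do rewrite /= Ex_cst.
  apply: le_Ex => [||x]; do ?[exact: bnd_indicator].
  by rewrite /far; case: (n < x.2)%N; rewrite ?orbT.
have far_b : Ex b (fun x => (n < x.1.2)%:R) <= Ex v (fun x => (far n x)%:R).
  rewrite Ex_garbled2; last first.
    exact: (bnd_indicator R (fun x : outcome K => (n < x.1.2)%N)).
  under eq_Ex do rewrite /= Ex_cst.
  apply: le_Ex => [||x]; do ?[exact: bnd_indicator].
  by rewrite /far; case: (n < x.1.2)%N.
have min0 x : 0 <= Num.min (a x) (b x) by rewrite le_min !pmf_ge0.
have sm := asum_min (pmf_ge0 a) (pmf_ge0 b) (asum_pmf a).
have sn : asum (fun x => Num.min (a x) (b x) * near n x).
  exact: asum_finite_support (finite_near K n) min0.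
have sa : asum (fun x => a x * (n < x.2)%:R).
  exact/asum_Ex/(bnd_indicator R (fun x : outcome K => (n < x.2)%N)).
have sb : asum (fun x => b x * (n < x.1.2)%:R).
  exact/asum_Ex/(bnd_indicator R (fun x : outcome K => (n < x.1.2)%N)).
apply: le_trans (lerD (lexx _) (lerD far_a far_b)).
rewrite /Ex -tsumD// -tsumD//; last exact: asumD.
apply: le_tsum => //; first by apply: asumD => //; exact: asumD.
have a0 := pmf_ge0 a; have b0 := pmf_ge0 b.
move=> x; rewrite /near; have [far_x|near_x] := boolP (far n x).
  rewrite memNset ?mulr0 ?add0r; last by apply/negP; rewrite negbK.
  case/orP: far_x => ->; rewrite mulr1.
    by rewrite ler_wpDl ?mulr_ge0// ge_min lexx orbT.
  by rewrite ler_wpDr ?mulr_ge0// ge_min lexx.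
by rewrite mem_set// mulr1 lerDl addr_ge0 ?mulr_ge0.
Qed.

(** The limit [r] may have lost mass; [p] completes it. *)
Lemma garbling_limit (U : set_system nat) (q : nat -> garbling R) :
  UltraFilter U -> (forall m, supported (q m)) ->
  exists (r : nat -> nat -> R) (p : garbling R),
    [/\ forall c c', q m c c' @[m --> U] --> r c c',
        forall c c', r c c' <= p c c' & supported p].
Proof.
move=> UU qD; have PU : ProperFilter U by exact: ultra_proper.
have /choice[r' rP] (y : nat * nat) :
    exists l : R, q m y.1 y.2 @[m --> U] --> l.
  apply: (@ultra_bounded_cvg _ _ _ _ 1) => m.
  by rewrite ger0_norm ?pmf_ge0 ?pmf_le1.
pose r c c' := r' (c, c').
have rP' c c' : q m c c' @[m --> U] --> r c c' by exact: (rP (c, c')).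
have r_sub c : [/\ forall c', 0 <= r c c', asum (r c) & tsum (r c) <= 1].
  apply: (@le_tsum_lim _ _ _ U (fun m => q m c) _ _ PU) => // m.
  - by move=> c'; exact: pmf_ge0.
  - exact: asum_pmf.
  - by rewrite tsum_pmf.
have rD c c' : ~~ D c' -> r c c' = 0.
  move=> nD; apply/eqP; rewrite eq_le; apply/andP; split.
    by apply: cvg_le_bound (rP' c c') _ => m; rewrite qD.
  by have [r0 _ _] := r_sub c.
have /choice[p pP] c : exists p : prob R nat,
    (forall c', r c c' <= p c') /\ forall c', c' != 0%N -> p c' = r c c'.
  by have [r0 sr r1] := r_sub c; exact: complete_subprobability.
exists r, p; split=> // [c c'|c c' nD]; first exact: (pP c).1.
rewrite (pP c).2 ?rD//; apply: contraNneq nD => ->; exact: D0.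
Qed.

(** Up to a uniformly small tail the overlap is a sum over finitely many
    outcomes, which is continuous along the ultrafilter. *)
Lemma min_gap_attained : exists q1 q2, [/\ supported q1, supported q2 &
  forall q1' q2', supported q1' -> supported q2' ->
    tv_dist (garble1 q1 u) (garble2 v q2) <=
    tv_dist (garble1 q1' u) (garble2 v q2')].
Proof.
pose S := [set r | exists q1 q2, [/\ supported q1, supported q2 & r = ov q1 q2]].
have zeroD : supported (fun=> point R 0%N).
  move=> c c' nD /=; rewrite mulr1; case: eqP nD => // ->.
  by rewrite D0.
have supS : has_sup S.
  split; first by exists (ov (fun=> point R 0%N) (fun=> point R 0%N)),
    (fun=> point R 0%N), (fun=> point R 0%N).
  by exists 1 => _ [q1 [q2 [_ _ ->]]]; exact: overlap_le1.
have /choice[qq qqP] (m : nat) : exists qq : garbling R * garbling R,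
    [/\ supported qq.1, supported qq.2 & sup S - harmonic m < ov qq.1 qq.2].
  have m0 : 0 < harmonic m :> R by rewrite /= invr_gt0.
  have [_ [q1 [q2 [q1D q2D ->]]] lt_ov] := sup_adherent m0 supS.
  by exists (q1, q2).
have [U [UU ooU]] := @ultraFilterLemma nat \oo _.
have PU : ProperFilter U by exact: ultra_proper.
have [|r1 [p1 [r1P rp1 p1D]]] := @garbling_limit U (fun m => (qq m).1) UU.
  by move=> m; have [] := qqP m.
have [|r2 [p2 [r2P rp2 p2D]]] := @garbling_limit U (fun m => (qq m).2) UU.
  by move=> m; have [] := qqP m.
pose a m := garbled1 (qq m).1 u; pose b m := garbled2 v (qq m).2.
pose a_lim x := tsum (fun c => u (upd1 x c) * r1 c (signal1 x)).
pose b_lim x := tsum (fun d => v (upd2 x d) * r2 d (signal2 x)).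
have r_ge0 (r : nat -> nat -> R) (q : nat -> garbling R) c c' :
    (forall c c', q m c c' @[m --> U] --> r c c') -> 0 <= r c c'.
  by move=> qr; apply: cvg_ge_bound (qr c c') _ => m; exact: pmf_ge0.
have row_cvg (T : outcome K -> nat -> outcome K) (coord : outcome K -> nat)
    (coord_upd : forall x c, coord (T x c) = c) (w : info R K)
    (q : nat -> garbling R) (r : nat -> nat -> R) x :
    (forall c c', q m c c' @[m --> U] --> r c c') ->
    tsum (fun c => w (T x c) * q m c (coord x)) @[m --> U] -->
    tsum (fun c => w (T x c) * r c (coord x)).
  move=> qr; apply: (@cvg_tsum _ _ _ _ _ _ (fun c => w (T x c))).
  - move=> m c; rewrite ger0_norm ?mulr_ge0 ?pmf_ge0//.
    by rewrite ler_piMr ?pmf_ge0 ?pmf_le1.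
  - exact: asum_fibre coord_upd w x.
  - by move=> c; apply: cvgM => //; exact: cvg_cst.
have a_cvg x : a m x @[m --> U] --> a_lim x.
  have -> : (fun m => a m x) =
      (fun m => garble (@signal1 K) (@upd1 K) u (qq m).1 x).
    by apply/funext => m; exact: garbledE.
  exact: (@row_cvg (@upd1 K) (@signal1 K) (fun _ _ => erefl) u
    (fun m => (qq m).1) r1 x r1P).
have b_cvg x : b m x @[m --> U] --> b_lim x.
  have -> : (fun m => b m x) =
      (fun m => garble (@signal2 K) (@upd2 K) v (qq m).2 x).
    by apply/funext => m; exact: garbledE.
  exact: (@row_cvg (@upd2 K) (@signal2 K) (fun _ _ => erefl) v
    (fun m => (qq m).2) r2 x r2P).
have row_le (T : outcome K -> nat -> outcome K) (coord : outcome K -> nat)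
    (coord_upd : forall x c, coord (T x c) = c) (w : info R K)
    (p : garbling R) (r : nat -> nat -> R) x :
    (forall c c', 0 <= r c c') -> (forall c c', r c c' <= p c c') ->
    tsum (fun c => w (T x c) * r c (coord x)) <=
    tsum (fun c => w (T x c) * p c (coord x)).
  move=> r0 rp; have sp : asum (fun c => w (T x c) * p c (coord x)).
    apply: le_asum (asum_fibre coord_upd w x) => c.
    rewrite ger0_norm ?mulr_ge0 ?pmf_ge0//.
    by rewrite ler_piMr ?pmf_ge0 ?pmf_le1.
  apply: le_tsum => //.
    apply: le_asum sp => c; rewrite ger0_norm ?mulr_ge0 ?pmf_ge0//.
    by rewrite ler_wpM2l ?pmf_ge0.
  by move=> c; rewrite ler_wpM2l ?pmf_ge0.
have a_le x : a_lim x <= garbled1 p1 u x.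
  rewrite /garbled1 garbledE.
  apply: (@row_le (@upd1 K) (@signal1 K) (fun _ _ => erefl)) => // c c'.
  exact: r_ge0 r1P.
have b_le x : b_lim x <= garbled2 v p2 x.
  rewrite /garbled2 garbledE.
  apply: (@row_le (@upd2 K) (@signal2 K) (fun _ _ => erefl)) => // c c'.
  exact: r_ge0 r2P.
have sup_le_ov : sup S <= ov p1 p2.
  apply/ler_addgt0Pr => e e0; have e2 : 0 < e / 2 by rewrite divr_gt0.
  have [n1 far1] := far_tail u e2; have [n2 far2] := far_tail v e2.
  pose n := maxn n1 n2.
  have tail := lerD (far1 n (leq_maxl _ _)) (far2 n (leq_maxr _ _)).
  have near_cvg : tsum (fun x => Num.min (a m x) (b m x) * near n x)
      @[m --> U] --> tsum (fun x => Num.min (a_lim x) (b_lim x) * near n x).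
    apply: (@cvg_tsum _ _ _ _ _ _ (fun x => 1 * near n x)).
    - move=> m x; rewrite ger0_norm ?ler_wpM2r ?ler0n//.
        by rewrite ge_min pmf_le1.
      by rewrite mulr_ge0 ?ler0n// le_min !pmf_ge0.
    - exact: asum_finite_support (finite_near K n) _.
    - by move=> x; apply: cvgM; [exact: cvg_min|exact: cvg_cst].
  have near_le : tsum (fun x => Num.min (a_lim x) (b_lim x) * near n x) <=
      ov p1 p2.
    have a0 x : 0 <= a_lim x.
      by apply: cvg_ge_bound (a_cvg x) _ => m; exact: pmf_ge0.
    have b0 x : 0 <= b_lim x.
      by apply: cvg_ge_bound (b_cvg x) _ => m; exact: pmf_ge0.
    have m0 x : 0 <= Num.min (a_lim x) (b_lim x) by rewrite le_min a0 b0.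
    apply: le_tsum; first exact: asum_finite_support (finite_near K n) m0.
      exact/asum_min/asum_pmf/pmf_ge0/pmf_ge0.
    move=> x; apply: (@le_trans _ _ (Num.min (a_lim x) (b_lim x))).
      by rewrite ler_piMr// /near; case: (x \in _).
    exact: le_min2.
  have limit : tsum (fun x => Num.min (a m x) (b m x) * near n x) + harmonic m
      @[m --> U] --> tsum (fun x => Num.min (a_lim x) (b_lim x) * near n x) + 0.
    by apply: cvgD => //; exact: cvg_trans (cvg_app _ ooU) cvg_harmonic.
  have : sup S - e <=
      tsum (fun x => Num.min (a_lim x) (b_lim x) * near n x) + 0.
    apply: cvg_ge_bound limit _ => m; have [_ _] := qqP m.
    have := overlap_tight n (qq m).1 (qq m).2; rewrite -/(a m) -/(b m).
    move: tail; rewrite -splitr.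
    by move: (ov _ _) (tsum _) (_ + _) (harmonic m) (sup S) => *; lra.
  by rewrite addr0; move: near_le; lra.
exists p1, p2; split=> // q1' q2' q1D q2D.
rewrite !garble1E !garble2E !tv_overlap lerD2l lerN2 ler_pM2l//.
apply: le_trans sup_le_ov; apply: ub_le_sup; first by case: supS.
by exists q1', q2'.
Qed.

End Attainment.

(** * The value-based distance *)
Section ValueDistance.
Variables (R : realType) (K : finType).
Implicit Types u v : info R K.

Definition gains u v := [set r | exists (I J : finType) (g : K -> I -> J -> R),
    in_G g /\ r = game_value v g - game_value u g].

Let trivial_game : in_G (fun (_ : K) (_ _ : unit) => 0 : R).
Proof. by split; rewrite ?card_unit// => *; rewrite lerN10 ler01. Qed.

Lemma has_sup_gains u v : has_sup (gains u v).
Proof.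
split.
  by eexists; exists unit, unit, (fun _ _ _ => 0); split;
    first exact: trivial_game.
exists 2 => _ [I [J [g [gG ->]]]].
move: (norm_value_le1 gG u) (norm_value_le1 gG v).
move: (game_value u g) (game_value v g) => a b.
by rewrite !ler_norml => /andP[? _] /andP[_ ?]; lra.
Qed.

Lemma le_val_gain u v (I J : finType) (g : K -> I -> J -> R) : in_G g ->
  game_value v g - game_value u g <= val_gain u v.
Proof.
move=> gG; apply: ub_le_sup; first by case: (has_sup_gains u v).
by exists I, J, g.
Qed.

Lemma val_gain_le_tv u v q1 q2 :
  val_gain u v <= tv_dist (garble1 q1 u) (garble2 v q2).
Proof.
apply: ge_sup; first by case: (has_sup_gains u v).
by move=> _ [I [J [g [gG ->]]]]; exact: value_gap_le_tv.
Qed.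

(** Weak duality at a minimizing pair of garblings on one side; on the other,
    the dual games with more and more labels, whose defect tends to [0]. *)
Lemma val_gain_minimum u v : is_minimum (garbling_gaps u v) (val_gain u v).
Proof.
split; last by move=> _ [q1 [q2 ->]]; exact: val_gain_le_tv.
have [q1 [q2 [_ _ min_q]]] := @min_gap_attained R K u v predT isT.
exists q1, q2; apply/eqP; rewrite eq_le val_gain_le_tv/=.
apply/ler_addgt0Pr => e e0; have e4 : 0 < e / 4 by rewrite divr_gt0.
have [n1 far1] := far_tail u e4; have [n2 far2] := far_tail v e4.
have [|g [gG gP]] := dual_game (far1 _ (leq_maxl n1 n2))
    (far2 _ (leq_maxr n1 n2)) (m := tv_dist (garble1 q1 u) (garble2 v q2)).
  by move=> q1' q2' _ _; exact: min_q.
have := le_trans (le_value_gap gG gP) (le_val_gain u v gG).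
lra.
Qed.

Lemma Pr1_complement u (A : set (outcome K)) : Pr u A = 1%E ->
  Ex u (fun x => (x \notin A)%:R) = 0.
Proof.
move=> uA.
have in_A : Ex u (fun x => (x \in A)%:R) = 1.
  apply: EFin_inj; rewrite -uA /Pr -esumEtsum; last exact/asum_Ex/bnd_indicator.
    rewrite [RHS]esum_mkcond; apply: eq_esum => x _.
    by case: ifP => _; rewrite ?mulr1 ?mulr0.
  by move=> x; rewrite mulr_ge0 ?pmf_ge0.
transitivity (Ex u (fun x => 1 - (x \in A)%:R)).
  by apply: eq_Ex => x; case: (x \in A); rewrite ?subrr ?subr0.
rewrite ExB ?Ex_cst ?in_A ?subrr//; first exact: bnd_cst.
exact: bnd_indicator.
Qed.

Lemma bounded_signals_near u n : in_info n.+1 u ->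
  Ex u (fun x => (far n x)%:R) <= 0.
Proof.
rewrite /in_info subn1 /= => -[/Pr1_complement u1 /Pr1_complement u2].
rewrite -[0]addr0 -{1}u1 -u2 -ExD//; do ?[exact: bnd_indicator].
apply: le_Ex; [exact: bnd_indicator|by apply: bndD; exact: bnd_indicator|move=> x].
rewrite /far; have [cn|nc] := leqP x.1.2 n => /=.
  have [dn|nd] := leqP x.2 n => /=; first by rewrite addr_ge0.
  by rewrite [in X in _ <= _ + X]memNset ?lerDr//=; apply/negP; rewrite -ltnNge.
by rewrite memNset ?lerDl//=; apply/negP; rewrite -ltnNge.
Qed.

(** With [n + 1] signals the dual game has no defect and its optimum is
    sandwiched between the gap of the best [n + 1]-valued garblings and the
    gain, hence all three agree. *)
Lemma bounded_optima (n : nat) u v : in_info n.+1 u -> in_info n.+1 v ->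
  exists (g : K -> 'I_n.+1 -> 'I_n.+1 -> R) (q1 q2 : garbling R),
    [/\ in_G g, in_garbling n.+1 q1, in_garbling n.+1 q2,
        game_value v g - game_value u g = val_gain u v &
        tv_dist (garble1 q1 u) (garble2 v q2) = val_gain u v].
Proof.
move=> /bounded_signals_near un /bounded_signals_near vn.
have [q1 [q2 [q1n q2n min_q]]] :=
  @min_gap_attained R K u v (fun c => c < n.+1)%N isT.
have in_supported q : in_garbling n.+1 q -> supported (fun c => c < n.+1)%N q.
  by move=> qn c c'; rewrite -leqNgt; exact: qn.
have supported_in q : supported (fun c => c < n.+1)%N q -> in_garbling n.+1 q.
  by move=> qn c c' nc; apply: qn; rewrite -leqNgt.
have [|g [gG gP]] := dual_game un vn
    (m := tv_dist (garble1 q1 u) (garble2 v q2)).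
  by move=> q1' q2' q1'n q2'n; apply: min_q; exact: in_supported.
have := le_value_gap gG gP; rewrite mulr0 subr0 => le_gap.
have gap_le := le_val_gain u v gG.
have gain_le := val_gain_le_tv u v q1 q2.
exists g, q1, q2; split; do ?[exact: supported_in] => //; apply/eqP; rewrite eq_le.
  by rewrite gap_le (le_trans gain_le).
by rewrite gain_le (le_trans le_gap).
Qed.

Lemma garbling_gaps'E u v : garbling_gaps' u v = garbling_gaps v u.
Proof.
by apply/seteqP; split=> _ [q1 [q2 ->]]; exists q2, q1; exact: tv_distC.
Qed.

Lemma val_dist_max u v : val_dist u v = Num.max (val_gain u v) (val_gain v u).
Proof.
have absE (I J : finType) (g : K -> I -> J -> R) : in_G g ->
    `|game_value u g - game_value v g| <= Num.max (val_gain u v) (val_gain v u).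
  move=> gG; rewrite ler_norml lerNl opprB; apply/andP; split.
    by apply: le_trans (le_val_gain u v gG) _; rewrite le_max; apply/orP; left.
  by apply: le_trans (le_val_gain v u gG) _; rewrite le_max; apply/orP; right.
have abs_sup (I J : finType) (g : K -> I -> J -> R) : in_G g ->
    `|game_value u g - game_value v g| <= val_dist u v.
  move=> gG; apply: ub_le_sup; last by exists I, J, g.
  exists (Num.max (val_gain u v) (val_gain v u)).
  by move=> _ [I' [J' [g' [g'G ->]]]]; exact: absE.
apply/eqP; rewrite eq_le ge_max; apply/and3P; split.
- apply: ge_sup; last by move=> _ [I [J [g [gG ->]]]]; exact: absE.
  by eexists; exists unit, unit, (fun _ _ _ => 0); split;
    first exact: trivial_game.
- apply: ge_sup; first by case: (has_sup_gains u v).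
  move=> _ [I [J [g [gG ->]]]]; apply: le_trans (abs_sup _ _ _ gG).
  by rewrite distrC; exact: ler_norm.
- apply: ge_sup; first by case: (has_sup_gains v u).
  move=> _ [I [J [g [gG ->]]]]; apply: le_trans (abs_sup _ _ _ gG).
  exact: ler_norm.
Qed.

End ValueDistance.

Theorem theorem1 (R : realType) (K : finType) (hK : (2 <= #|K|)%N) :
  [/\ forall u v : info R K,
        is_minimum (garbling_gaps u v) (val_gain u v),
      forall (L : nat) (u v : info R K), (1 <= L)%N ->
        in_info L u -> in_info L v ->
        (exists (I J : finType) (g : K -> I -> J -> R),
            in_GL L g /\ game_value v g - game_value u g = val_gain u v) /\
        (exists q1 q2 : garbling R,
            [/\ in_garbling L q1, in_garbling L q2 &
                is_minimum (garbling_gaps u v)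
                  (tv_dist (garble1 q1 u) (garble2 v q2))])
    & forall u v : info R K,
        exists m1 m2 : R,
          [/\ is_minimum (garbling_gaps u v) m1,
              is_minimum (garbling_gaps' u v) m2 &
              val_dist u v = Num.max m1 m2]].
Proof.
split.
- exact: val_gain_minimum.
- move=> [|n] u v // _ un vn.
  have [g [q1 [q2 [gG q1n q2n g_opt q_opt]]]] := bounded_optima un vn.
  split; first by exists 'I_n.+1, 'I_n.+1, g; split; rewrite // /in_GL card_ord.
  by exists q1, q2; split=> //; rewrite q_opt; exact: val_gain_minimum.
- move=> u v; exists (val_gain u v), (val_gain v u); split.
  + exact: val_gain_minimum.
  + by rewrite garbling_gaps'E; exact: val_gain_minimum.
  + exact: val_dist_max.
Qed.
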